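(* For $\tau_1,\tau_2>0$ and $t>0$ put, for $i=1,2$, $$\lambda_i:=\frac{1+t}{\tau_i+1+t},\qquad \sigma_i:=\frac{(\tau_i-t)(\tau_{3-i}+1)}{(\tau_i-t)(\tau_{3-i}-t)-(1+t)^2},$$ $$\tilde\psi_t(\tau_1,\tau_2):=1-\sigma_1\lambda_1-\sigma_2\lambda_2,$$ $$\tilde\varphi_t(\tau_1,\tau_2):=\frac{t\left((\tau_1-t)(\tau_2-t)-(1+t)^2\right)}{(\tau_1-t)(\tau_2-t)+(1+t)^2\left(2\max(\tau_1,\tau_2)+1\right)}\,\tilde\psi_t(\tau_1,\tau_2).$$ Let $(\tau_1,\tau_2)$ lie in region $IV$, i.e. $\tau_1,\tau_2>0$ and $\tau_1^2\tau_2^2-4\tau_1\tau_2-2\tau_1-2\tau_2-1>0$. Then $\tilde\varphi_t(\tau_1,\tau_2)>0$ for infinitely many $t$ with $0<t<\frac{\tau_1\tau_2-1}{\tau_1+\tau_2+2}$, and for each such $t$ the following holds: for all interleaved compact sets $C_1,C_2\subset\mathbb R$ with $\tau(C_1)\ge\tau_1$ and $\tau(C_2)\ge\tau_2$, there is a compact set $K\subset C_1\cap C_2$ with $\tau(K)\ge\tilde\varphi_t(\tau_1,\tau_2)$.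
   Context: Two compact subsets of $\mathbb R$ are interleaved if each meets the interior of the convex hull of the other. Write $|E|=\operatorname{diam}(E)$. Thickness $\tau$ of a compact set $C\subset\mathbb R$: a set $P$ is a chunk of $C$ (written $P\propto C$) if $P=C\cap I$ for some closed interval $I$, $P$ is a nonempty proper subset of $C$, and $d(P,C\setminus P)>0$. If $C$ has a chunk, $\tau(C)=\inf_{P\propto C}|P|/d(P,C\setminus P)$; otherwise $\tau(C)=0$ if $C$ is empty or a single point and $\tau(C)=\infty$ if $C$ is an interval of positive length. *)

(* Defs.v *)
From mathcomp Require Import all_boot all_order all_algebra.
From mathcomp Require Import all_classical all_reals.
From mathcomp Require Import ereal topology normedtype convex.

Set Implicit Arguments.
Unset Strict Implicit.
Unset Printing Implicit Defensive.

Import Order.TTheory GRing.Theory Num.Theory.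
Import numFieldNormedType.Exports.

Local Open Scope classical_set_scope.
Local Open Scope ring_scope.

Section thickness.
Context {R : realType}.
Implicit Types (A B C P : set R) (t tau : R).

(* [sup] and [inf] are real-valued: [diam] is meaningful for nonempty bounded
   sets, [set_dist] for nonempty sets; chunks of compact sets satisfy both. *)
Definition diam A : R := sup [set `|x - y| | x in A & y in A].

Definition set_dist A B : R := inf [set `|x - y| | x in A & y in B].

Definition chunk C P : Prop :=
  [/\ exists a b : R, P = C `&` [set` `[a, b]],
      P !=set0, P `<` C & 0 < set_dist P (C `\` P)].

(* A compact set without chunk is empty, a point or a nondegenerate segment, so
   for compact sets the last branch is exactly "empty or a single point". *)
Definition thickness C : \bar R :=
  if `[< exists P, chunk C P >] then
    ereal_inf [set (diam P / set_dist P (C `\` P))%:E | P in chunk C]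
  else if `[< exists a b : R, a < b /\ C = [set` `[a, b]] >] then +oo%E
  else 0%E.

Definition convex_hull A : set R := smallest (@convex_set R R^o) A.

Definition interleaved A B : Prop :=
  A `&` interior (convex_hull B) !=set0 /\
  B `&` interior (convex_hull A) !=set0.

Definition lambda t tau1 : R := (1 + t) / (tau1 + 1 + t).

(* [sigma t tau1 tau2] is sigma_1, and [sigma t tau2 tau1] is sigma_2. *)
Definition sigma t tau1 tau2 : R :=
  ((tau1 - t) * (tau2 + 1)) / ((tau1 - t) * (tau2 - t) - (1 + t) ^+ 2).

Definition psi t tau1 tau2 : R :=
  1 - sigma t tau1 tau2 * lambda t tau1 - sigma t tau2 tau1 * lambda t tau2.

Definition phi t tau1 tau2 : R :=
  (t * ((tau1 - t) * (tau2 - t) - (1 + t) ^+ 2)) /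
  ((tau1 - t) * (tau2 - t) + (1 + t) ^+ 2 * (2 * Num.max tau1 tau2 + 1)) *
  psi t tau1 tau2.

Definition region_IV tau1 tau2 : Prop :=
  [/\ 0 < tau1, 0 < tau2 &
      0 < tau1 ^+ 2 * tau2 ^+ 2 - 4 * tau1 * tau2 - 2 * tau1 - 2 * tau2 - 1].

End thickness.

(* Main.v *)
(* Fix t and call a gap of C1 and a gap of C2 linked when their distance is at
   most t times the size of the smaller one.  Two gaps of the same set are far
   apart compared with the smaller one, so the sizes along a path of linked gaps
   have no local minimum, once suitably normalised: they decrease geometrically
   away from the largest one, and a geometric series bounds how far a component
   of the link graph extends beyond any of its gaps.  Remove from an interval
   between a gap of one set and a gap of the other the hulls of all the
   components, and let K be what remains.  For two neighbouring components one
   finds a pair of gaps of different types, one in each component and not linked,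
   at a distance L of which a proportion psi is left after removing both
   components, and L is large compared with the span of the component whose
   largest gap is the smaller one. *)
Require Import Defs.
From mathcomp Require Import all_boot all_order all_algebra.
From mathcomp Require Import all_classical all_reals.
From mathcomp Require Import ereal topology normedtype convex derive.
From mathcomp Require Import ring lra.

Import Order.TTheory GRing.Theory Num.Theory.
Import numFieldNormedType.Exports.

Local Open Scope classical_set_scope.
Local Open Scope ring_scope.

(** * Real inequalities *)

(** A component may contain infinitely many gaps and its ends need not be attained. The estimates
    are therefore made for finite duplicate-free paths of linked gaps, and the ends of a component
    are approached up to an error that is absorbed only when chunks of [K] are compared with the
    empty space around them. Origin of the constants: of three successive linked gaps, the smaller
    outer one is at most $(1+t)/(\tau_i-t)$ times the middle one. The bound on $t$ says precisely
    that $(1+t)^2<(\tau_1-t)(\tau_2-t)$, so two such steps contract, and $\sigma_i$ sums the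
    resulting geometric series. A gap of size $a$ sticks out of its neighbour by at most $(1+t)a$
    and must still leave a bridge $\tau_i a$ to the next gap of its type; $\lambda_i$ is the worst
    proportion this gives. The fraction in front of $\tilde\psi_t$ is a lower bound for the ratio of
    [L] to the span. It costs a case distinction because of the two neighbours of a largest gap only
    the smaller is known to be small. *)

Section span_inequalities.
Context {R : realFieldType}.

(* Here k1 and k2 stand for tau_i - t, sizes are relative to the largest gap of a
   component, which has type 1, v and b are the sizes of its two neighbours of
   type 2 in a path, S * a / D bounds the extension of a path whose first gap has
   size a and type 2, and L is the distance between the chosen pair of gaps. *)

Lemma span_small (t q k1 k2 m b v L D S : R) :
  0 < t -> q = 1 + t -> 0 < k1 -> 0 < k2 -> 0 < D -> D = k1 * k2 - q ^+ 2 ->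
  S = q * k2 * (k1 + q) -> k1 <= m ->
  k2 <= q -> b <= 1 -> v <= 1 -> k1 - 1 <= L ->
  t * (D + S * (v + b)) <= (D + 2 * q ^+ 2 * (m + q)) * L.
Proof.
move=> t0 qE k10 k20 D0 DE SE km kq b1 v1 hL.
have q0 : 0 < q by lra.
have k1q : q < k1.
  have h : q ^+ 2 < k1 * q.
    apply: (@lt_le_trans _ _ (k1 * k2)); first by lra.
    by rewrite ler_pM2l.
  by move: h; rewrite expr2 ltr_pM2r.
(* [k1] exceeds [q = 1 + t], so [k1 - 1 <= L] already gives [t <= L] and the crude bounds on [v] and
   [b] suffice. *)
have tL : t <= L by lra.
have SS : S <= q ^+ 2 * (m + q).
  rewrite SE expr2 ler_pM ?mulr_ge0 ?ler_pM2l //; lra.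
have S0 : 0 <= S by rewrite SE !mulr_ge0 //; lra.
have h1 : S * (v + b) <= 2 * (q ^+ 2 * (m + q)).
  apply: (@le_trans _ _ (S * 2)); last by lra.
  by apply: ler_wpM2l => //; lra.
rewrite [leRHS]mulrC.
have h2 : D + S * (v + b) <= D + 2 * q ^+ 2 * (m + q) by lra.
have h3 : 0 <= D + 2 * q ^+ 2 * (m + q).
  by have := sqr_ge0 q; nra.
apply: (@le_trans _ _ (t * (D + 2 * q ^+ 2 * (m + q)))).
  by rewrite ler_pM2l.
exact: ler_wpM2r.
Qed.

(** Splits the extension into a multiple of [D] and a term that [q ^+ 2 * (m + q)] absorbs. *)
Lemma S_E {q k1 k2 D S : R} : D = k1 * k2 - q ^+ 2 -> S = q * k2 * (k1 + q) ->
  S = q * D + q ^+ 2 * (k2 + q).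
Proof. by move=> -> ->; ring. Qed.

(** The neighbour [b] facing the other component is small. This leaves a surplus [D / k2] of [L]
    over [t], which pays for a far neighbour [v] of full size. *)
Lemma span_near (t q k1 k2 m b v L D S : R) :
  0 < t -> q = 1 + t -> 0 < k1 -> 0 < k2 -> 0 < D -> D = k1 * k2 - q ^+ 2 ->
  S = q * k2 * (k1 + q) -> k1 <= m -> k2 <= m ->
  q < k2 -> k2 * b <= q -> v <= 1 -> t + D / k2 <= L ->
  t * (D + S * (v + b)) <= (D + 2 * q ^+ 2 * (m + q)) * L.
Proof.
move=> t0 qE k10 k20 D0 DE SE km1 km2 kq bq v1 hL.
have q0 : 0 < q by lra.
have S0 : 0 <= S by rewrite SE !mulr_ge0 //; lra.
have Sb : S * b <= q ^+ 2 * (k1 + q).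
  have -> : S * b = q * (k1 + q) * (k2 * b) by rewrite SE; ring.
  have -> : q ^+ 2 * (k1 + q) = q * (k1 + q) * q by ring.
  apply: ler_wpM2l => //; rewrite mulr_ge0 //; lra.
have Sv : S * v <= q * D + q ^+ 2 * (k2 + q).
  rewrite -(S_E DE SE); rewrite -[leRHS]mulr1; exact: ler_wpM2l.
set y := D / k2 in hL.
have yD : y * k2 = D by rewrite /y divfK // gt_eqF.
have y0 : 0 < y by rewrite divr_gt0.
clearbody y.
have q20 : 0 < q ^+ 2 by rewrite exprn_gt0.
have B0 : 0 <= D + 2 * q ^+ 2 * (m + q).
  by rewrite addr_ge0 ?mulr_ge0 //; lra.
apply: (@le_trans _ _ ((D + 2 * q ^+ 2 * (m + q)) * (t + y))); last exact: ler_wpM2l.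
have Sbv : D + S * (v + b) <= D + q * D + q ^+ 2 * (k2 + q) + q ^+ 2 * (k1 + q) by
  rewrite mulrDr; lra.
apply: (@le_trans _ _ (t * (D + q * D + q ^+ 2 * (k2 + q) + q ^+ 2 * (k1 + q)))).
  by rewrite ler_pM2l.
have e1 : t * (q ^+ 2 * (k1 + q)) <= t * (q ^+ 2 * (m + q)).
  by rewrite !ler_pM2l // lerD2r.
have e2 : t * (q ^+ 2 * (k2 + q)) <= t * (q ^+ 2 * (m + q)).
  by rewrite !ler_pM2l // lerD2r.
have e3 : q ^+ 2 * (k2 * y) <= q ^+ 2 * ((m + q) * y).
  by rewrite ler_pM2l // ler_pM2r //; lra.
have e4 : t * (q * D) <= q ^+ 2 * (k2 * y).
  rewrite [k2 * y]mulrC yD mulrA ler_pM2r // expr2 ler_pM2r //; lra.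
have e5 : 0 <= D * y by rewrite mulr_ge0 // ltW.
have mq0 : 0 <= m + q by lra.
have e6 : 0 <= q ^+ 2 * ((m + q) * y) by rewrite !mulr_ge0 // ltW.
lra.
Qed.

(** Now the far neighbour [v] is the small one and [b] may reach 1. The bound on [L] is
    [k1 + t - q * b] at [b = 1]. *)
Lemma span_far_large (t q k1 k2 m b v L D S : R) :
  0 < t -> q = 1 + t -> 0 < k1 -> 0 < k2 -> 0 < D -> D = k1 * k2 - q ^+ 2 ->
  S = q * k2 * (k1 + q) -> k1 <= m -> k2 <= m ->
  q < k2 -> q <= k1 -> b <= 1 -> k2 * v <= q -> k1 - 1 <= L ->
  t * (D + S * (v + b)) <= (D + 2 * q ^+ 2 * (m + q)) * L.
Proof.
move=> t0 qE k10 k20 D0 DE SE km1 km2 kq k1q b1 vq hL.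
have q0 : 0 < q by lra.
have S0 : 0 <= S by rewrite SE !mulr_ge0 //; lra.
have Sv : S * v <= q ^+ 2 * (k1 + q).
  have -> : S * v = q * (k1 + q) * (k2 * v) by rewrite SE; ring.
  have -> : q ^+ 2 * (k1 + q) = q * (k1 + q) * q by ring.
  apply: ler_wpM2l => //; rewrite mulr_ge0 //; lra.
have Sb : S * b <= q * D + q ^+ 2 * (k2 + q).
  rewrite -(S_E DE SE); rewrite -[leRHS]mulr1; exact: ler_wpM2l.
have q20 : 0 < q ^+ 2 by rewrite exprn_gt0.
have B0 : 0 <= D + 2 * q ^+ 2 * (m + q).
  by rewrite addr_ge0 ?mulr_ge0 //; lra.
apply: (@le_trans _ _ ((D + 2 * q ^+ 2 * (m + q)) * (k1 - 1))); last exact: ler_wpM2l.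
have Sbv : D + S * (v + b) <= D + q * D + q ^+ 2 * (k2 + q) + q ^+ 2 * (k1 + q) by
  rewrite mulrDr; lra.
apply: (@le_trans _ _ (t * (D + q * D + q ^+ 2 * (k2 + q) + q ^+ 2 * (k1 + q)))).
  by rewrite ler_pM2l.
have [k12|k21] := leP k2 k1.
- have e1 : q ^+ 2 * (k1 + q) * (k1 - 1) <= q ^+ 2 * (m + q) * (k1 - 1).
    by rewrite ler_wpM2r ?ler_pM2l ?lerD2r //; lra.
  apply: (@le_trans _ _ ((D + 2 * q ^+ 2 * (k1 + q)) * (k1 - 1))); last by lra.
  have a1 : 0 <= (k1 - k2) by lra.
  have a2 : 0 <= (k1 - q) by lra.
  have tE : t = q - 1 by lra.
  have tk : t <= k1 - 1 by lra.
  have f1 : t * (D + q ^+ 2 * (k1 + q)) <= (k1 - 1) * (D + q ^+ 2 * (k1 + q)).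
    by apply: ler_wpM2r => //; apply: addr_ge0; [exact: ltW|apply: mulr_ge0; lra].
  suff f2 : t * (q * D + q ^+ 2 * (k2 + q)) <= (k1 - 1) * (q ^+ 2 * (k1 + q)) by lra.
  rewrite -(S_E DE SE) SE.
  have f3 : t * k2 <= (k1 - 1) * q.
    have : t * k2 <= t * k1 by rewrite ler_pM2l.
    suff : 0 <= (k1 - 1) * q - t * k1 by lra.
    have -> : (k1 - 1) * q - t * k1 = k1 - q by rewrite tE; ring.
    lra.
  have -> : t * (q * k2 * (k1 + q)) = (t * k2) * (q * (k1 + q)) by ring.
  have -> : (k1 - 1) * (q ^+ 2 * (k1 + q)) = ((k1 - 1) * q) * (q * (k1 + q)) by ring.
  by apply: ler_wpM2r => //; rewrite mulr_ge0 //; lra.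
- have e1 : q ^+ 2 * (k2 + q) * (k1 - 1) <= q ^+ 2 * (m + q) * (k1 - 1).
    by rewrite ler_wpM2r ?ler_pM2l ?lerD2r //; lra.
  apply: (@le_trans _ _ ((D + 2 * q ^+ 2 * (k2 + q)) * (k1 - 1))); last by lra.
  have a1 : 0 < k2 - k1 by lra.
  have a2 : 0 <= k1 - q by lra.
  have -> : t = q - 1 by lra.
  have ? : 1 < q by lra.
  rewrite DE.
  rewrite -subr_ge0.
  (* Measured from the corner of the region [1 < q <= k1 < k2], the difference of the two sides is a
     polynomial with nonnegative coefficients. *)
  set x := k1 - q; set y := k2 - k1; set z := q - 1.
  have x0 : 0 <= x by []. have y0 : 0 < y by []. have z0 : 0 < z by rewrite /z; lra.
  have -> : k2 = 1 + z + x + y by rewrite /x /y /z; ring.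
  have -> : k1 = 1 + z + x by rewrite /x /z; ring.
  have -> : q = 1 + z by rewrite /z; ring.
  clear - x0 y0 z0; clearbody x y z.
  rewrite [X in 0 <= X](_ : _ = 4*x + 4*x*x + 3*x*y + 10*x*z + x*x*x + x*x*y
    + 5*x*x*z + 4*x*y*z + 8*x*z*z + x*x*z*z + x*y*z*z + 2*x*z*z*z); last by ring.
  by rewrite !addr_ge0 ?mulr_ge0 // ltW.
Qed.

(** For [k1 < q] the bound [k1 - 1] falls below [t], so the two lower bounds on [L], one increasing
    and one decreasing in [b], have to be played against each other. *)
Lemma span_far_small (t q k1 k2 m b v L D S : R) :
  0 < t -> q = 1 + t -> 0 < k1 -> 0 < k2 -> 0 < D -> D = k1 * k2 - q ^+ 2 ->
  S = q * k2 * (k1 + q) -> k2 <= m ->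
  k1 < q -> b <= 1 -> k2 * v <= q -> t * b <= L -> k1 + t - q * b <= L ->
  t * (D + S * (v + b)) <= (D + 2 * q ^+ 2 * (m + q)) * L.
Proof.
move=> t0 qE k10 k20 D0 DE SE km2 k1q b1 vq hL1 hL2.
have q0 : 0 < q by lra.
have S0 : 0 <= S by rewrite SE !mulr_ge0 //; lra.
have q20 : 0 < q ^+ 2 by rewrite exprn_gt0.
have Sv : S * v <= q ^+ 2 * (k1 + q).
  have -> : S * v = q * (k1 + q) * (k2 * v) by rewrite SE; ring.
  have -> : q ^+ 2 * (k1 + q) = q * (k1 + q) * q by ring.
  apply: ler_wpM2l => //; rewrite mulr_ge0 //; lra.
(* The size at which both lower bounds on [L] agree: [t * b0 = k1 + t - q * b0]. *)
set b0 := (k1 + t) / (q + t).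
have b0E : b0 * (q + t) = k1 + t by rewrite /b0 divfK // gt_eqF //; lra.
have b00 : 0 < b0 by rewrite divr_gt0 //; lra.
have b01 : b0 <= 1 by rewrite ler_pdivrMr ?mul1r //; lra.
pose A := D + q ^+ 2 * (k1 + q).
pose B := D + 2 * q ^+ 2 * (k2 + q) - S.
have A0 : 0 < A by rewrite addr_gt0 // mulr_gt0 //; lra.
have AB : A <= b0 * B.
  have h : 0 <= (k1 + t) * B - (q + t) * A.
    have -> : (k1 + t) * B - (q + t) * A = t * (q - k1) * (q + k1) * k2.
      by rewrite /A /B SE DE qE; ring.
    by rewrite !mulr_ge0 //; lra.
  rewrite /b0 mulrAC ler_pdivlMr; last by lra.
  by rewrite mulrC; lra.
have B0 : 0 < B by rewrite -(pmulr_rgt0 _ b00) (lt_le_trans A0).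
(* The larger of [b] and [b0] may replace [b]: the left side only grows, and [t * be <= L] still
   holds. *)
have [be [h1 h2 h3]] : exists be, [/\ b0 <= be, b <= be & t * be <= L].
  have [bb|bb] := leP b0 b; first by exists b.
  exists b0; split => //; first exact: ltW.
  apply: le_trans hL2.
  have : q * b <= q * b0 by rewrite ler_pM2l // ltW.
  lra.
have ABe : A <= be * B by apply: (le_trans AB); rewrite ler_pM2r.
have Sb : S * b <= S * be by apply: ler_wpM2l.
have N0 : 0 < D + 2 * q ^+ 2 * (k2 + q) by rewrite addr_gt0 // ?mulr_gt0 //; lra.
apply: (@le_trans _ _ ((D + 2 * q ^+ 2 * (k2 + q)) * (t * be))); last first.
  apply: ler_pM => //; first exact: ltW.
    by rewrite mulr_ge0 // ?ltW //; lra.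
  by rewrite lerD2l ler_pM2l ?mulr_gt0 // lerD2r.
rewrite [leRHS]mulrCA ler_pM2l //.
have -> : (D + 2 * q ^+ 2 * (k2 + q)) * be = be * B + S * be by rewrite /B; ring.
by rewrite mulrDr; rewrite /A in ABe; lra.
Qed.

(** [b] and [v] flank the largest gap, so the smaller of them is at most [q / k2]; which one it is
    decides the case. *)
Lemma span_case_c (t q k1 k2 m b v L D S : R) :
  0 < t -> q = 1 + t -> 0 < k1 -> 0 < k2 -> 0 < D -> D = k1 * k2 - q ^+ 2 ->
  S = q * k2 * (k1 + q) -> k1 <= m -> k2 <= m ->
  b <= 1 -> v <= 1 -> k2 * b <= q \/ k2 * v <= q ->
  t * b <= L -> k1 + t - q * b <= L ->
  t * (D + S * (v + b)) <= (D + 2 * q ^+ 2 * (m + q)) * L.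
Proof.
move=> t0 qE k10 k20 D0 DE SE km1 km2 b1 v1 bv hL1 hL2.
have q0 : 0 < q by lra.
have hL : k1 - 1 <= L.
  apply: le_trans hL2; have : q * b <= q * 1 by rewrite ler_pM2l.
  lra.
have [k2q|k2q] := leP k2 q; first exact: (@span_small t q k1 k2).
case: bv => [bq|vq].
  apply: (@span_near t q k1 k2) => //; apply: le_trans hL2.
  rewrite -[k1](mulfK (lt0r_neq0 k20)) DE.
  have h : q * b <= q ^+ 2 / k2.
    rewrite ler_pdivlMr // -mulrA expr2 ler_pM2l //; lra.
  rewrite mulrBl; lra.
have [qk1|k1q] := leP q k1; first exact: (@span_far_large t q k1 k2).
exact: (@span_far_small t q k1 k2).
Qed.

(** [e] is [D] times the extension on the facing side, bounded here through [L] instead of a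
    neighbour. When [t <= L] fails, the last alternative is what remains of [t * x <= L] and
    [k1 + t - q * x <= L] after elimination of [x]. *)
Lemma span_case_b1 (t q k1 k2 m v e L D S : R) :
  0 < t -> q = 1 + t -> 0 < k1 -> 0 < k2 -> 0 < D -> D = k1 * k2 - q ^+ 2 ->
  S = q * k2 * (k1 + q) -> k1 <= m -> k2 <= m -> 0 <= L ->
  k2 * v <= L + 1 -> k2 * e <= S * L ->
  (t <= L \/ k1 <= q /\ (k1 + t) * t <= (q + t) * L) ->
  t * (D + S * v + e) <= (D + 2 * q ^+ 2 * (m + q)) * L.
Proof.
move=> t0 qE k10 k20 D0 DE SE km1 km2 L0 vL eL hL.
have q0 : 0 < q by lra.
have Sv : S * v <= q * (k1 + q) * (L + 1).
  have -> : S * v = q * (k1 + q) * (k2 * v) by rewrite SE; ring.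
  apply: ler_wpM2l => //; rewrite mulr_ge0 //; lra.
have eS : e <= q * (k1 + q) * L.
  rewrite -(ler_pM2l k20); apply: (le_trans eL); rewrite SE.
  by have -> : k2 * (q * (k1 + q) * L) = q * k2 * (k1 + q) * L by ring.
have c1 : t * (q * (k1 + q) * L) <= t * (q * (m + q) * L).
  by rewrite ler_pM2l // ler_wpM2r // ler_pM2l // lerD2r.
apply: (@le_trans _ _ (t * (D + q * (k1 + q) * (2 * L + 1)))).
  by rewrite ler_pM2l // ; lra.
suff c2 : t * (D + q * (k1 + q)) <= L * (D + 2 * q * (m + q)).
  have -> : (D + 2 * q ^+ 2 * (m + q)) * L =
    L * (D + 2 * q * (m + q)) + 2 * (t * (q * (m + q) * L)).
    by rewrite qE; ring.
  have -> : t * (D + q * (k1 + q) * (2 * L + 1)) = t * (D + q * (k1 + q)) + 2 * (t * (q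
    * (k1 + q) * L)) by ring.
  lra.
case: hL => [tL|[k1q hL]].
  apply: ler_pM => //; [exact: ltW| |].
    by apply: addr_ge0; [exact: ltW|apply: mulr_ge0; lra].
  have : q * (k1 + q) <= q * (m + q) by rewrite ler_pM2l // lerD2r.
  have : 0 <= q * (m + q) by apply: mulr_ge0; lra.
  lra.
have c3 : (q + t) * (D + q * (k1 + q)) <= (k1 + t) * (D + 2 * q * (k2 + q)).
  rewrite -subr_ge0 -(pmulr_rge0 _ k10).
  have -> : k1 * ((k1 + t) * (D + 2 * q * (k2 + q)) - (q + t) * (D + q * (k1 + q))) =
    D * (k1 ^+ 2 + q * k1 + 2 * q * t) + q * (k1 + q) * (k1 + 2 * q * t).
    by rewrite DE qE; ring.
  by rewrite !(addr_ge0, mulr_ge0, exprn_ge0) // ltW.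
have qt0 : 0 < q + t by lra.
rewrite -(ler_pM2l qt0).
apply: (@le_trans _ _ (t * ((k1 + t) * (D + 2 * q * (k2 + q))))).
  by rewrite mulrCA ler_pM2l.
rewrite mulrA [t * _]mulrC mulrA.
have K0 : 0 <= D + 2 * q * (k2 + q) by rewrite addr_ge0 ?mulr_ge0 //; lra.
apply: (@le_trans _ _ ((q + t) * L * (D + 2 * q * (k2 + q)))).
  exact: ler_wpM2r.
rewrite ler_wpM2l ?mulr_ge0 //; first by lra.
by rewrite lerD2l -mulrA -mulrA ler_pM2l // ler_pM2l // lerD2r.
Qed.

Lemma span_case_b2 (t q k1 k2 m b v x L D S : R) :
  0 < t -> q = 1 + t -> 0 < k1 -> 0 < k2 -> 0 < D -> D = k1 * k2 - q ^+ 2 ->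
  S = q * k2 * (k1 + q) -> k1 <= m -> k2 <= m -> q <= k2 ->
  v <= 1 -> k2 * b <= q -> (k2 + t) * x <= L + 1 + t * v -> k1 + t - q * x <= L ->
  t * (D + S * (v + b)) <= (D + 2 * q ^+ 2 * (m + q)) * L.
Proof.
move=> t0 qE k10 k20 D0 DE SE km1 km2 qk2 v1 bq xL hL.
have q0 : 0 < q by lra.
have S0 : 0 <= S by rewrite SE !mulr_ge0 //; lra.
have q20 : 0 < q ^+ 2 by rewrite exprn_gt0.
pose K := k2 + q; have K0 : 0 < K by rewrite /K; lra.
have Sb : S * b <= q ^+ 2 * (k1 + q).
  have -> : S * b = q * (k1 + q) * (k2 * b) by rewrite SE; ring.
  have -> : q ^+ 2 * (k1 + q) = q * (k1 + q) * q by ring.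
  apply: ler_wpM2l => //; rewrite mulr_ge0 //; lra.
have Sv : S * v <= S by rewrite -[leRHS]mulr1; exact: ler_wpM2l.
(* Elimination of [x], which the bridge bounds above and [L] bounds below, leaves a single lower
   bound on [L]. *)
have hZ : D + t * (k1 - q) <= (L - t) * (K + t).
  have h1 : (k2 + t) * (k1 + t - q * x) <= (k2 + t) * L by rewrite ler_pM2l //; lra.
  have h2 : q * ((k2 + t) * x) <= q * (L + q).
    rewrite ler_pM2l //; apply: (le_trans xL).
    have : t * v <= t * 1 by rewrite ler_pM2l.
    lra.
  have e1 : (k2 + t) * (k1 + t - q * x) = (k2 + t) * (k1 + t) - q * ((k2 + t) * x) by ring.
  rewrite -subr_ge0.
  have -> : (L - t) * (K + t) - (D + t * (k1 - q)) =
    (k2 + t) * L + q * (L + q) - (k2 + t) * (k1 + t) by rewrite /K DE; ring.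
  lra.
have L0 : 0 <= L.
  suff : 0 <= L * (K + t) by rewrite pmulr_lge0 //; lra.
  have -> : L * (K + t) = (L - t) * (K + t) + t * (K + t) by ring.
  apply: (@le_trans _ _ (D + t * (k1 - q) + t * (K + t))); last by rewrite lerD2r.
  have -> : D + t * (k1 - q) + t * (K + t) = D + t * (k1 + k2 + t) by rewrite /K; ring.
  by rewrite addr_ge0 ?mulr_ge0 ?addr_ge0 // ltW.
have bnd : t * (D + S * (v + b)) <= t * (D + S + q ^+ 2 * (k1 + q)).
  by rewrite ler_pM2l // mulrDr; lra.
apply: (le_trans bnd).
have [qk1|k1q] := leP q k1.
  set d := L - t in hZ.
  have d0 : 0 <= d.
    suff : 0 <= d * (K + t) by rewrite pmulr_lge0 //; lra.
    apply: le_trans hZ; rewrite addr_ge0 ?mulr_ge0 //; lra.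
  have -> : L = t + d by rewrite /d; ring.
  rewrite (S_E DE SE) -/K.
  have f1 : t * (q ^+ 2 * (k1 + q)) <= t * (q ^+ 2 * (m + q)).
    by rewrite !ler_pM2l // lerD2r.
  have f2 : t * (q ^+ 2 * K) <= t * (q ^+ 2 * (m + q)).
    by rewrite !ler_pM2l // lerD2r.
  have f3 : t * q * D <= d * (2 * q ^+ 2 * K).
    apply: (@le_trans _ _ (t * q * (d * (K + t)))).
      rewrite ler_pM2l ?mulr_gt0 //; apply: le_trans hZ.
      have : 0 <= t * (k1 - q) by rewrite mulr_ge0 //; lra.
      lra.
    have -> : t * q * (d * (K + t)) = d * (t * q * (K + t)) by ring.
    apply: ler_wpM2l => //.
    have -> : 2 * q ^+ 2 * K = t * q * (K + t) + q * ((q + 1) * (K - 2 * q) + 2 * q * (q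
      + 1) - t * t).
      by rewrite qE; ring.
    rewrite lerDl mulr_ge0 //; first exact: ltW.
    have g1 : 0 <= (q + 1) * (K - 2 * q) by rewrite mulr_ge0 // /K; lra.
    have g2 : t * t <= q * q by apply: ler_pM; lra.
    have g3 : 0 < q * q by rewrite mulr_gt0.
    lra.
  have f4 : d * (2 * q ^+ 2 * K) <= d * (2 * q ^+ 2 * (m + q)).
    by rewrite ler_wpM2l // ler_pM2l ?mulr_gt0 // lerD2r.
  have f5 : 0 <= d * D by rewrite mulr_ge0 // ltW.
  lra.
apply: (@le_trans _ _ ((D + 2 * q ^+ 2 * K) * L)); last first.
  by apply: ler_wpM2r => //; rewrite lerD2l ler_pM2l ?mulr_gt0 // lerD2r.
have e1 : t * (D + S + q ^+ 2 * (k1 + q)) = (D + 2 * q ^+ 2 * K) * t - t * q * (q - k1) * K.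
  by rewrite SE DE /K; ring.
rewrite e1.
suff : (t - L) * (D + 2 * q ^+ 2 * K) <= t * q * (q - k1) * K by lra.
have KK : 0 < K + t by lra.
rewrite -(ler_pM2l KK).
have N0 : 0 <= D + 2 * q ^+ 2 * K by rewrite addr_ge0 ?mulr_ge0 // ltW.
apply: (@le_trans _ _ ((t * (q - k1) - D) * (D + 2 * q ^+ 2 * K))).
  rewrite mulrA; apply: ler_wpM2r => //; lra.
set w := q - k1; have w0 : 0 < w by rewrite /w; lra.
have g1 : t * w * D <= 2 * q ^+ 2 * K * D.
  rewrite ler_pM2r //; apply: (@le_trans _ _ (q * q)).
    by apply: ler_pM; rewrite /w; lra.
  have -> : 2 * q ^+ 2 * K = q * q * (2 * K) by ring.
  by rewrite -[leLHS]mulr1 ler_pM2l ?mulr_gt0 // /K; lra.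
have g2 : 2 * q * (t * q * w * K) <= (K + t) * (t * q * w * K).
  by rewrite ler_pM2r ?mulr_gt0 // /K; lra.
have g3 : 0 <= D * D by rewrite mulr_ge0 // ltW.
lra.
Qed.
End span_inequalities.

Section span_homogeneous.
Context {R : realFieldType}.

Lemma ler_of_pmulr (g x y : R) : 0 < g -> x * g <= y * g -> x <= y.
Proof. by move=> g0; rewrite ler_pM2r. Qed.

(** Everything is homogeneous of degree one in sizes and distances; division by the size [g] of the
    largest gap gives the normalised inequality. *)
Lemma span_facing (t q k1 k2 m g b v L D S : R) :
  0 < t -> q = 1 + t -> 0 < k1 -> 0 < k2 -> 0 < D -> D = k1 * k2 - q ^+ 2 ->
  S = q * k2 * (k1 + q) -> k1 <= m -> k2 <= m -> 0 < g ->
  b <= g -> v <= g -> k2 * b <= q * g \/ k2 * v <= q * g ->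
  t * b <= L -> (k1 + t) * g - q * b <= L ->
  t * (D * g + S * (v + b)) <= (D + 2 * q ^+ 2 * (m + q)) * L.
Proof.
move=> t0 qE k10 k20 D0 DE SE km1 km2 g0.
have gE x : x = x / g * g by rewrite divfK // gt_eqF.
rewrite (gE b) (gE v) (gE L); move: (b / g) (v / g) (L / g) => b' v' L'.
move=> b1 v1 bv h1 h2.
have H := @span_case_c _ t q k1 k2 m b' v' L' D S t0 qE k10 k20 D0 DE SE km1 km2.
have {H} : t * (D + S * (v' + b')) <= (D + 2 * q ^+ 2 * (m + q)) * L'.
  apply: H; [| |case: bv => ?; [left|right]| |]; apply: (@ler_of_pmulr g) => //; lra.
by rewrite -(ler_pM2r g0) => h; lra.
Qed.

(** [x] is the size of the gap of the other component that is paired with the largest gap; it has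
    the type of [b] and [v]. [e] has two bounds, one through [b] and one through [L], and the
    comparison of [x] with [v] selects the one to use. *)
Lemma span_away (t q k1 k2 m g b v x e L D S : R) :
  0 < t -> q = 1 + t -> 0 < k1 -> 0 < k2 -> 0 < D -> D = k1 * k2 - q ^+ 2 ->
  S = q * k2 * (k1 + q) -> k1 <= m -> k2 <= m -> 0 < g ->
  b <= x -> 0 <= x -> x <= g -> v <= g -> e <= S * b -> k2 * e <= S * L ->
  t * x <= L -> (k1 + t) * g - q * x <= L ->
  (k2 + t) * Num.min x v <= L + g + t * v -> k2 * Num.min b v <= q * g ->
  t * (D * g + S * v + e) <= (D + 2 * q ^+ 2 * (m + q)) * L.
Proof.
move=> t0 qE k10 k20 D0 DE SE km1 km2 g0.
have gE y : y = y / g * g by rewrite divfK // gt_eqF.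
have gmin y z : Num.min (y * g) (z * g) = Num.min y z * g.
  by rewrite minr_pMl // ltW.
have S0 : 0 < S by rewrite SE !mulr_gt0 //; lra.
rewrite (gE b) (gE v) (gE L) (gE x) (gE e) !gmin.
move: (b / g) (v / g) (L / g) (x / g) (e / g) => b' v' L' x' e'.
move=> bx x0 x1 v1 e1 e2 h1 h2 h3 h4.
suff : t * (D + S * v' + e') <= (D + 2 * q ^+ 2 * (m + q)) * L'.
  by rewrite -(ler_pM2r g0) => h; lra.
have {}bx : b' <= x' by apply: (@ler_of_pmulr g).
have {}x0 : 0 <= x' by apply: (@ler_of_pmulr g) => //; lra.
have {}x1 : x' <= 1 by apply: (@ler_of_pmulr g) => //; lra.
have {}v1 : v' <= 1 by apply: (@ler_of_pmulr g) => //; lra.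
have {}e1 : e' <= S * b' by apply: (@ler_of_pmulr g) => //; lra.
have {}e2 : k2 * e' <= S * L' by apply: (@ler_of_pmulr g) => //; lra.
have {}h1 : t * x' <= L' by apply: (@ler_of_pmulr g) => //; lra.
have {}h2 : k1 + t - q * x' <= L' by apply: (@ler_of_pmulr g) => //; lra.
have {}h3 : (k2 + t) * Num.min x' v' <= L' + 1 + t * v'.
  by apply: (@ler_of_pmulr g) => //; move: h3; set mm := Num.min _ _ => h3; lra.
have {}h4 : k2 * Num.min b' v' <= q.
  by apply: (@ler_of_pmulr g) => //; move: h4; set mm := Num.min _ _ => h4; lra.
have L0 : 0 <= L' by apply: le_trans h1; rewrite mulr_ge0 // ltW.
have q0 : 0 < q by lra.
have qx : q * x' <= q * 1 by rewrite ler_pM2l.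
have [vx|xv] := leP v' x'.
  apply: (@span_case_b1 _ t q k1 k2) => //.
    by move: h3; rewrite (min_idPr vx); lra.
  have [tL|Lt] := leP t L'; [by left|right; split; first lra].
  have : t * (k1 + t - q * x') <= t * L' by rewrite ler_pM2l.
  have : q * (t * x') <= q * L' by rewrite ler_pM2l.
  lra.
have bv : b' <= v' by apply: le_trans bx _; exact: ltW.
rewrite (min_idPl bv) in h4; rewrite (min_idPl (ltW xv)) in h3.
apply: (@le_trans _ _ (t * (D + S * (v' + b')))).
  by rewrite ler_pM2l // mulrDr; lra.
have [k2q|k2q] := leP q k2; first exact: (@span_case_b2 _ t q k1 k2 m b' v' x').
apply: (@span_small _ t q k1 k2) => //; [exact: ltW|lra|lra].
Qed.

(** Both neighbours have the type of the gap opposite, whose bridges bound each of them by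
    [(L + g) / k2]; one estimate covers all sizes. *)
Lemma span_unlike (t q k1 k2 m g b v L D S : R) :
  0 < t -> q = 1 + t -> 0 < k1 -> 0 < k2 -> 0 < D ->
  S = q * k2 * (k1 + q) -> k1 <= m -> k2 <= m -> 
  t * g <= L -> k2 * b <= L + g -> k2 * v <= L + g -> 0 <= L ->
  t * (D * g + S * (v + b)) <= (D + 2 * q ^+ 2 * (m + q)) * L.
Proof.
move=> t0 qE k10 k20 D0 SE km1 km2 tg kb kv L0.
have q0 : 0 < q by lra.
have P0 : 0 < q * (k1 + q) by rewrite mulr_gt0 //; lra.
have c1 : S * (v + b) <= q * (k1 + q) * (2 * (L + g)).
  have -> : S * (v + b) = q * (k1 + q) * (k2 * v + k2 * b) by rewrite SE; ring.
  by rewrite ler_pM2l //; lra.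
have c2 : t * (S * (v + b)) <= t * (q * (k1 + q) * (2 * (L + g))) by rewrite ler_pM2l.
have c3 : q * (k1 + q) * (2 * (t * L + t * g)) <= q * (k1 + q) * (2 * (t * L + L)).
  by rewrite ler_pM2l //; lra.
have c4 : D * (t * g) <= D * L by rewrite ler_pM2l.
have c5 : 2 * q ^+ 2 * (k1 + q) * L <= 2 * q ^+ 2 * (m + q) * L.
  by rewrite ler_wpM2r // ler_pM2l ?lerD2r // mulr_gt0 // exprn_gt0.
have c6 : q * (k1 + q) * (2 * (t * L + L)) = 2 * q ^+ 2 * (k1 + q) * L by rewrite qE; ring.
lra.
Qed.
End span_homogeneous.

(** * Paths of linked gaps *)

Section chains.
Context {R : realType} {t : R} {tau : bool -> R}.

(** The boolean tells which of the two sets the gap belongs to. The endpoints are plain data, so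
    that shortened outer gaps can be treated like genuine ones. *)
Definition gap : Type := (bool * R * R)%type.
Definition ty (g : gap) := g.1.1.
Definition lo (g : gap) := g.1.2.
Definition hi (g : gap) := g.2.
Definition sz (g : gap) := hi g - lo g.

(** The distances are signed: gaps of positive size and different types that overlap are linked. *)
Definition link (x y : gap) :=
  [&& ty x != ty y, lo y - hi x <= t * Num.min (sz x) (sz y)
    & lo x - hi y <= t * Num.min (sz x) (sz y)].

Definition spaced (G : set gap) :=
  (forall x, G x -> lo x < hi x) /\
  forall x y, G x -> G y -> ty x = ty y -> x <> y ->
    hi x + tau (ty x) * Num.min (sz x) (sz y) <= lo y \/
    hi y + tau (ty x) * Num.min (sz x) (sz y) <= lo x.

Definition kap c := tau c - t.
Definition sig c := sigma t (tau c) (tau (~~ c)).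
Definition slam c := sig c * lambda t (tau c).
Definition disc c := kap c * kap (~~ c) - (1 + t) ^+ 2.
(** The quantity [S] of the inequalities, that is [(1 + t) * sig c] cleared of its denominator
    [disc c]. *)
Definition ext c := (1 + t) * kap c * (kap (~~ c) + (1 + t)).

Lemma linkC : symmetric link.
Proof.
by move=> x y; rewrite /link eq_sym minC; case: (ty y != ty x) => //=; rewrite andbC.
Qed.

Hypothesis t0 : 0 < t.
Hypothesis kap0 : forall c, 0 < kap c.
Hypothesis disc0 : forall c, 0 < disc c.
Let q0 : 0 < 1 + t. Proof. by rewrite addr_gt0. Qed.

Lemma discC c : disc (~~ c) = disc c.
Proof. by rewrite /disc negbK [kap _ * _]mulrC. Qed.

Lemma tauE c : tau c = kap c + t. Proof. by rewrite /kap subrK. Qed.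

Lemma sigE c : disc c * ((1 + t) * sig c) = ext c.
Proof.
have d0 : disc c != 0 by rewrite gt_eqF.
rewrite /sig /sigma /ext -/(kap c) -/(kap (~~ c)) -/(disc c) tauE.
by field.
Qed.

(** The self-similarity of the geometric series: a total [sig c] consists of 1 for the first gap and
    of [sig (~~ c)] times the ratio [(1 + t) / kap (~~ c)] for the rest. *)
Lemma sig_rec c : kap (~~ c) * (sig c - 1) = (1 + t) * sig (~~ c).
Proof.
have d0 : disc c != 0 by rewrite gt_eqF.
apply: (mulfI d0).
have e1 : disc c * sig c = kap c * (kap (~~ c) + (1 + t)).
  have := sigE c; rewrite mulrCA /ext -mulrA => /mulfI; apply.
  by rewrite gt_eqF.
have -> : disc c * ((1 + t) * sig (~~ c)) = ext (~~ c).
  by rewrite -[disc c]discC sigE.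
have -> : disc c * (kap (~~ c) * (sig c - 1)) = kap (~~ c) * (disc c * sig c - disc c) by ring.
by rewrite e1 /ext /disc negbK; ring.
Qed.

Lemma ext_gt0 c : 0 < ext c.
Proof. by rewrite /ext !mulr_gt0 // addr_gt0. Qed.

Lemma sig_gt0 c : 0 < sig c.
Proof.
have := ext_gt0 c; rewrite -sigE pmulr_rgt0 // pmulr_rgt0 //.
Qed.

Lemma sig_gt1 c : 1 < sig c.
Proof.
rewrite -subr_gt0 -(pmulr_rgt0 _ (kap0 (~~ c))) sig_rec.
by rewrite mulr_gt0 // sig_gt0.
Qed.

Lemma link_ty x y : link x y -> ty y = ~~ ty x.
Proof. by case/and3P => h _ _; case: (ty x) h; case: (ty y). Qed.

Section fam.
Context {G : set gap} (HG : spaced G).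

Lemma sz_gt0 x : G x -> 0 < sz x.
Proof. by move=> Gx; rewrite subr_gt0; apply HG. Qed.

Lemma link_hi x y : link x y -> 0 < sz x -> 0 < sz y -> hi y <= hi x + (1 + t) * sz y.
Proof.
move=> /and3P[_ h _] sx sy.
have : t * Num.min (sz x) (sz y) <= t * sz y by rewrite ler_pM2l // ge_min lexx orbT.
have : hi y = lo y + sz y by rewrite /sz; lra.
lra.
Qed.

Lemma link_lo x y : link x y -> 0 < sz x -> 0 < sz y -> lo x - (1 + t) * sz y <= lo y.
Proof.
move=> /and3P[_ _ h] sx sy.
have : t * Num.min (sz x) (sz y) <= t * sz y by rewrite ler_pM2l // ge_min lexx orbT.
have : hi y = lo y + sz y by rewrite /sz; lra.
lra.
Qed.

(** The bridge between [x] and [z] is covered by [y] and two link distances. One of these is charged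
    to [y], the other to the smaller of [x] and [z], which turns [tau] into [kap]. *)
Lemma linked_triple x y z : G x -> G y -> G z -> link x y -> link y z -> x <> z ->
  kap (ty x) * Num.min (sz x) (sz z) <= (1 + t) * sz y.
Proof.
move=> Gx Gy Gz xy yz xz.
have txz : ty x = ty z by rewrite (link_ty _ _ yz) (link_ty _ _ xy) negbK.
have bound : tau (ty x) * Num.min (sz x) (sz z) <=
    sz y + t * Num.min (sz x) (sz y) + t * Num.min (sz y) (sz z).
  case/and3P: xy => _ a1 a2; case/and3P: yz => _ b1 b2.
  have yE : hi y = lo y + sz y by rewrite /sz; lra.
  by case: (HG.2 x z Gx Gz txz xz); lra.
have m1 : Num.min (sz x) (sz y) <= sz y by rewrite ge_min lexx orbT.
have m2 : Num.min (sz y) (sz z) <= sz y by rewrite ge_min lexx.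
have m3 : Num.min (sz x) (sz y) <= sz x by rewrite ge_min lexx.
have m4 : Num.min (sz y) (sz z) <= sz z by rewrite ge_min lexx orbT.
have T u v : u <= v -> t * u <= t * v by move=> ?; rewrite ler_pM2l.
have := T _ _ m1; have := T _ _ m2; have := T _ _ m3; have := T _ _ m4.
rewrite tauE in bound; move: bound; set k := kap _.
by case: (leP (sz x) (sz z)) => _; lra.
Qed.

(** This is the absence of a local minimum in normalised form. If the triple bounded [x] instead of
    [z], it would combine with the assumed step from [x] to [y] to contradict [disc0]. *)
Lemma descent x y z : G x -> G y -> G z -> link x y -> link y z -> x <> z ->
  kap (ty y) * sz y <= (1 + t) * sz x -> kap (ty z) * sz z <= (1 + t) * sz y.
Proof.
move=> Gx Gy Gz xy yz xz h.
have tz : ty z = ty x by rewrite (link_ty _ _ yz) (link_ty _ _ xy) negbK.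
have := linked_triple _ _ _ Gx Gy Gz xy yz xz; rewrite tz.
case: (leP (sz x) (sz z)) => // _ h2; exfalso.
have := disc0 (ty x); rewrite /disc -(link_ty _ _ xy).
have sy := sz_gt0 _ Gy; have sx := sz_gt0 _ Gx.
suff : kap (ty x) * kap (ty y) * sz y <= (1 + t) ^+ 2 * sz y.
  by rewrite ler_pM2r // => a; rewrite subr_gt0 ltNge a.
apply: (@le_trans _ _ (kap (ty x) * ((1 + t) * sz x))).
  by rewrite -mulrA ler_pM2l.
by rewrite mulrCA expr2 -mulrA ler_pM2l //.
Qed.

(* Sizes along a path decrease geometrically once they start to decrease, so
   the excursion of the path is bounded by the sum of a geometric series. *)
Lemma chain_bound h s : path link h s -> uniq (h :: s) ->
  (forall g, g \in h :: s -> G g) ->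
  (forall h2 s', s = h2 :: s' -> kap (ty h2) * sz h2 <= (1 + t) * sz h) ->
  forall g, g \in h :: s ->
  [/\ hi g <= hi h + (1 + t) * (sig (ty h) - 1) * sz h,
      lo h - (1 + t) * (sig (ty h) - 1) * sz h <= lo g &
      if ty g == ty h then sz g <= sz h else kap (ty g) * sz g <= (1 + t) * sz h].
Proof.
elim: s h => [|h2 s IH] h.
  move=> _ _ GG _ g; rewrite inE => /eqP ->; rewrite eqxx.
  have := sz_gt0 h (GG h (mem_head _ _)).
  have := sig_gt1 (ty h) => s1 szh.
  have : 0 <= (1 + t) * (sig (ty h) - 1) * sz h.
    by rewrite mulr_ge0 ?ltW // mulr_gt0 // subr_gt0.
  by move=> ?; split; lra.
move=> /[dup] pth /= /andP[lk pth2] /andP[hs un] GG d1 g.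
have Gh : G h by apply: GG; rewrite mem_head.
have Gh2 : G h2 by apply: GG; rewrite !inE eqxx orbT.
have szh := sz_gt0 _ Gh; have szh2 := sz_gt0 _ Gh2.
have d2 : kap (ty h2) * sz h2 <= (1 + t) * sz h by apply: d1.
have s1 : 1 < sig (ty h) := sig_gt1 _.
have e0 : 0 <= (1 + t) * (sig (ty h) - 1) * sz h.
  by rewrite mulr_ge0 ?ltW // mulr_gt0 // subr_gt0.
rewrite inE => /orP[/eqP ->|gs].
  by rewrite eqxx; split; lra.
have GG2 g' : g' \in h2 :: s -> G g' by move=> ?; apply: GG; rewrite inE; apply/orP; right.
have dd h3 s' : s = h3 :: s' -> kap (ty h3) * sz h3 <= (1 + t) * sz h2.
  move=> sE; move: pth2; rewrite sE /= => /andP[lk2 _].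
  apply: (@descent h h2 h3) => //.
    by apply: GG2; rewrite sE !inE eqxx orbT.
  by move=> hh3; move: hs; rewrite sE !inE hh3 eqxx orbT.
have [i1 i2 i3] := IH h2 pth2 un GG2 dd g gs.
have t2 := link_ty _ _ lk.
(* By [sig_rec], the allowance of [h] beyond itself pays for [h2], for the link to it and for the
   allowance of [h2]. *)
have key : (1 + t) * sig (ty h2) * sz h2 <= (1 + t) * (sig (ty h) - 1) * sz h.
  rewrite -(ler_pM2l (kap0 (ty h2))).
  have -> : kap (ty h2) * ((1 + t) * (sig (ty h) - 1) * sz h) =
     (1 + t) * sig (ty h2) * ((1 + t) * sz h).
    have := sig_rec (ty h); rewrite -t2 => e.
    by rewrite [LHS](_ : _ = (1 + t) * (kap (ty h2) * (sig (ty h) - 1)) * sz h); [rewrite e|]; ring.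
  rewrite mulrCA ler_pM2l //.
  by rewrite mulr_gt0 // sig_gt0.
have := link_hi _ _ lk szh szh2; have := link_lo _ _ lk szh szh2.
move=> l1 l2; split; [lra|lra|].
have k0 := kap0 (ty h2).
move: i3; rewrite t2; case: (ty g =P ~~ ty h) => [->|].
  have -> : (~~ ty h == ty h) = false by case: (ty h).
  by move=> i3; apply: le_trans d2; rewrite t2 ler_pM2l.
move=> /eqP; have -> : (ty g != ~~ ty h) = (ty g == ty h) by case: (ty g) (ty h) => [] [].
move=> tg; rewrite tg => i3.
have := disc0 (ty h); rewrite /disc -t2 => dd0.
rewrite -(ler_pM2l (mulr_gt0 (kap0 (ty h)) k0)).
apply: (@le_trans _ _ ((1 + t) * ((1 + t) * sz h))).
  apply: (@le_trans _ _ ((1 + t) * (kap (ty h2) * sz h2))); last by rewrite ler_pM2l //.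
  rewrite (eqP tg) in i3.
  have -> : kap (ty h) * kap (ty h2) * sz g = kap (ty h2) * (kap (ty h) * sz g) by ring.
  by rewrite [leRHS]mulrCA ler_pM2l.
by rewrite mulrA ler_pM2r // -expr2; lra.
Qed.

(** The third gap has the type of [h0] and is no larger, so the triple bounds it by [h1]. That
    starts the descent at [h1], whatever the size of [h1] itself. *)
Lemma neighbour_bound h0 h1 s : path link h0 (h1 :: s) -> uniq (h0 :: h1 :: s) ->
  (forall g, g \in h0 :: h1 :: s -> G g) ->
  (forall g, g \in h1 :: s -> ty g = ty h0 -> sz g <= sz h0) ->
  forall g, g \in h1 :: s ->
  [/\ hi g <= hi h1 + (1 + t) * (sig (ty h1) - 1) * sz h1,
      lo h1 - (1 + t) * (sig (ty h1) - 1) * sz h1 <= lo g &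
      ty g = ty h1 -> sz g <= sz h1].
Proof.
move=> /= /andP[lk pth] /andP[h0s un] GG le0 g gs.
have := chain_bound h1 s pth un _ _ g gs.
case=> [g' g's|h2 s' sE|a b c].
- by apply: GG; rewrite inE g's orbT.
- move: pth; rewrite sE /= => /andP[lk2 _].
  have t2 : ty h2 = ty h0 by rewrite (link_ty _ _ lk2) (link_ty _ _ lk) negbK.
  have h2s : h2 \in h1 :: s by rewrite sE !inE eqxx orbT.
  have h02 : h0 <> h2 by move=> e; move: h0s; rewrite e h2s.
  have := linked_triple h0 h1 h2 _ _ _ lk lk2 h02.
  rewrite (min_idPr (le0 _ h2s t2)) t2; apply; apply: GG.
  + by rewrite mem_head.
  + by rewrite !inE eqxx orbT.
  + by rewrite inE h2s orbT.
- by split => // e; move: c; rewrite e eqxx.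
Qed.

(* [p] is the distance by which the neighbour of size [a] protrudes. *)
Lemma protrusion c (p a L : R) : slam c <= 1 -> 0 <= a -> p <= (1 + t) * a ->
  p + tau c * a <= L ->
  p + (1 + t) * (sig c - 1) * a <= slam c * L.
Proof.
move=> sl1 a0 pa pL.
have l0 : 0 < tau c + 1 + t by rewrite tauE; by have := t0; have := kap0 c; lra.
have s0 : 0 <= slam c.
  by rewrite /slam /lambda; apply: mulr_ge0; [exact/ltW/sig_gt0|apply: divr_ge0; exact: ltW].
apply: (@le_trans _ _ (slam c * (p + tau c * a))); last exact: ler_wpM2l.
have e : slam c * (tau c + 1 + t) = sig c * (1 + t).
  by rewrite /slam /lambda mulrA divfK // gt_eqF.
have h : 0 <= (1 - slam c) * ((1 + t) * a - p) by rewrite mulr_ge0 // subr_ge0.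
have e2 : slam c * (tau c + 1 + t) * a = sig c * (1 + t) * a by rewrite e.
lra.
Qed.
End fam.
End chains.

(** * The distance between two components *)

Section main_estimate.
Context {R : realType} {t : R} {tau : bool -> R}.
Hypothesis t0 : 0 < t.
Hypothesis kap0 : forall c, 0 < kap (t:=t) (tau:=tau) c.
Hypothesis disc0 : forall c, 0 < disc (t:=t) (tau:=tau) c.
Hypothesis psi0 : 0 < psi t (tau true) (tau false).
Notation kap := (kap (t:=t) (tau:=tau)).
Notation disc := (disc (t:=t) (tau:=tau)).
Notation sig := (sig (t:=t) (tau:=tau)).
Notation slam := (slam (t:=t) (tau:=tau)).
Notation ext := (ext (t:=t) (tau:=tau)).
Notation link := (link (t:=t)).
Notation gap := (gap (R:=R)).

Lemma slam_ge0 c : 0 <= slam c.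
Proof.
rewrite /slam /lambda; apply: mulr_ge0; first exact/ltW/sig_gt0.
have := kap0 c; rewrite /kap => ?; have := t0 => ?.
apply: divr_ge0; lra.
Qed.

Lemma psiE c : psi t (tau true) (tau false) = 1 - slam c - slam (~~ c).
Proof. by case: c => //=; rewrite /psi /slam /sig /= addrAC. Qed.

Lemma slam_le1 c : slam c <= 1.
Proof. by have := psi0; rewrite (psiE c); have := slam_ge0 (~~ c); lra. Qed.

(** Brings the bound [slam c * L] on an extension into the form [k2 * e <= S * L]; the factor given
    away is [kap c / (tau c + 1 + t)]. *)
Lemma ext_slam c L : 0 <= L -> kap c * (disc c * (slam c * L)) <= ext c * L.
Proof.
move=> L0.
have -> : kap c * (disc c * (slam c * L)) = kap c * disc c * slam c * L by ring.
apply: ler_wpM2r => //.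
have k0 := kap0 c; have := t0 => t0'.
have l0 : 0 < tau c + 1 + t by rewrite (tauE (t:=t) (tau:=tau)); lra.
have -> : kap c * disc c * slam c = ext c * (kap c / (tau c + 1 + t)).
  by rewrite -sigE // /slam /lambda; ring.
rewrite -[leRHS]mulr1 ler_pM2l ?ext_gt0 // ler_pdivrMr // mul1r (tauE (t:=t) (tau:=tau)); lra.
Qed.

Context {G : set gap} (HG : spaced (tau:=tau) G).

Lemma minsz_gt0 x y : G x -> G y -> 0 < Num.min (sz x) (sz y).
Proof. by move=> Gx Gy; rewrite lt_min !(sz_gt0 HG). Qed.

Lemma spaced_lt x y : G x -> G y -> ty x = ty y -> hi x <= lo y ->
  hi x + tau (ty x) * Num.min (sz x) (sz y) <= lo y.
Proof.
move=> Gx Gy txy xy.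
have sx := sz_gt0 HG _ Gx; have sy := sz_gt0 HG _ Gy; rewrite /sz in sx sy.
have xNy : x <> y by move=> e; move: xy; rewrite e; lra.
have [//|] := HG.2 x y Gx Gy txy xNy.
have ta : 0 < tau (ty x) by rewrite (tauE (t:=t) (tau:=tau)); have := kap0 (ty x); have := t0; lra.
have := mulr_gt0 ta (minsz_gt0 _ _ Gx Gy); lra.
Qed.

Lemma unlinked_gap x y : G x -> G y -> ty y = ~~ ty x -> hi x <= lo y -> ~~ link x y ->
  t * Num.min (sz x) (sz y) < lo y - hi x.
Proof.
move=> Gx Gy txy xy; rewrite /link txy.
have -> : (ty x != ~~ ty x) = true by case: (ty x).
rewrite ltNge => /=; apply: contra => -> /=.
have := mulr_gt0 t0 (minsz_gt0 _ _ Gx Gy).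
have := sz_gt0 HG _ Gx; have := sz_gt0 HG _ Gy; rewrite /sz; lra.
Qed.

(** The first gap of [p] has the type of [h] and is no larger, so a bridge proportional to it fits
    before [h]. Its protrusion and the series that follows then take only the share [slam] of the
    distance. *)
Lemma ext_right g p h : path link g p -> uniq (g :: p) ->
  (forall x, x \in g :: p -> G x) -> G h -> ty h = ~~ ty g ->
  (forall x, x \in g :: p -> hi x <= lo h) ->
  (forall x, x \in p -> ty x = ty g -> sz x <= sz g) ->
  (forall x, x \in p -> ty x = ty h -> sz x <= sz h) ->
  hi (last g p) <= hi g + slam (ty h) * (lo h - hi g).
Proof.
case: p => [|a s] pth un GG Gh tgh le_h same other.
  rewrite /= lerDl mulr_ge0 ?slam_ge0 // subr_ge0; apply: le_h; exact: mem_head.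
have ps : path link g (a :: s) := pth.
have /= /andP[lk _] := pth.
have ap : a \in a :: s := mem_head _ _.
have ap' : a \in g :: a :: s by rewrite inE ap orbT.
have ta : ty a = ty h by rewrite tgh (link_ty _ _ lk).
have gp : g \in g :: a :: s := mem_head _ _.
have Gg := GG _ gp; have Ga := GG _ ap'.
have [b1 _ _] := neighbour_bound t0 kap0 disc0 HG g a s ps un GG same _ (mem_last a s).
rewrite /=; apply: (le_trans b1).
have hA := spaced_lt _ _ Ga Gh ta (le_h _ ap').
rewrite (min_idPl (other _ ap ta)) in hA.
have szg := sz_gt0 HG _ Gg; have sza := sz_gt0 HG _ Ga.
have l1 := link_hi t0 _ _ lk szg sza.
have h1 : hi a - hi g <= (1 + t) * sz a by lra.
have h2 : hi a - hi g + tau (ty a) * sz a <= lo h - hi g by lra.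
have := protrusion t0 kap0 disc0 _ _ _ _ (slam_le1 (ty a)) (ltW sza) h1 h2.
by rewrite -ta; lra.
Qed.

Lemma ext_left g p h : path link g p -> uniq (g :: p) ->
  (forall x, x \in g :: p -> G x) -> G h -> ty h = ~~ ty g ->
  (forall x, x \in g :: p -> hi h <= lo x) ->
  (forall x, x \in p -> ty x = ty g -> sz x <= sz g) ->
  (forall x, x \in p -> ty x = ty h -> sz x <= sz h) ->
  lo g - slam (ty h) * (lo g - hi h) <= lo (last g p).
Proof.
case: p => [|a s] pth un GG Gh tgh le_h same other.
  rewrite /= gerBl mulr_ge0 ?slam_ge0 // subr_ge0; apply: le_h; exact: mem_head.
have ps : path link g (a :: s) := pth.
have /= /andP[lk _] := pth.
have ap : a \in a :: s := mem_head _ _.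
have ap' : a \in g :: a :: s by rewrite inE ap orbT.
have ta : ty h = ty a by rewrite tgh (link_ty _ _ lk).
have gp : g \in g :: a :: s := mem_head _ _.
have Gg := GG _ gp; have Ga := GG _ ap'.
have [_ b1 _] := neighbour_bound t0 kap0 disc0 HG g a s ps un GG same _ (mem_last a s).
rewrite /=; apply: le_trans b1.
have hA := spaced_lt _ _ Gh Ga ta (le_h _ ap').
rewrite (min_idPr (other _ ap (esym ta))) ta in hA.
have szg := sz_gt0 HG _ Gg; have sza := sz_gt0 HG _ Ga.
have l1 := link_lo t0 _ _ lk szg sza.
have h1 : lo g - lo a <= (1 + t) * sz a by lra.
have h2 : lo g - lo a + tau (ty a) * sz a <= lo g - hi h by lra.
have := protrusion t0 kap0 disc0 _ _ _ _ (slam_le1 (ty a)) (ltW sza) h1 h2.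
by rewrite ta; lra.
Qed.

(* [v] is the size of the first gap of [p], or 0 when [p] is empty. *)
Lemma branch_size g p : path link g p -> uniq (g :: p) ->
  (forall x, x \in g :: p -> G x) -> (forall x, x \in p -> sz x <= sz g) ->
  exists2 v, [/\ 0 <= v, v <= sz g, disc (ty g) * (hi (last g p) - hi g) <= ext (~~ ty g) * v &
                 disc (ty g) * (lo g - lo (last g p)) <= ext (~~ ty g) * v] &
    [/\ forall h, G h -> ty h = ~~ ty g -> (forall x, x \in p -> hi h <= lo x) ->
       hi h + tau (ty h) * Num.min (sz h) v <= Num.max (hi h) (hi g + t * v),
       p = [::] -> v = 0,
       forall b s, p = b :: s -> v = sz b &
       forall h, G h -> link h g -> h \notin p -> kap (ty h) * Num.min (sz h) v <= (1 + t) * sz g].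
Proof.
case: p => [|a s] pth un GG le_g.
  have Gg := GG _ (mem_head _ _); have szg := sz_gt0 HG _ Gg.
  exists 0; rewrite /= ?subrr ?mulr0; split => //; first exact: ltW.
    move=> h Gh _ _; rewrite (min_idPr (ltW (sz_gt0 HG _ Gh))).
    by rewrite mulr0 addr0 le_max lexx.
  move=> h Gh _ _; rewrite (min_idPr (ltW (sz_gt0 HG _ Gh))) mulr0.
  by apply: mulr_ge0; [rewrite addr_ge0 // ltW|exact: ltW].
have ps : path link g (a :: s) := pth.
have /= /andP[lk _] := pth.
have ap : a \in a :: s := mem_head _ _.
have ap' : a \in g :: a :: s by rewrite inE ap orbT.
have ta := link_ty _ _ lk.
have Gg := GG _ (mem_head _ _); have Ga := GG _ ap'.
have same x : x \in a :: s -> ty x = ty g -> sz x <= sz g by move=> ? _; apply: le_g.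
have [b1 b2 _] := neighbour_bound t0 kap0 disc0 HG g a s ps un GG same _ (mem_last a s).
have szg := sz_gt0 HG _ Gg; have sza := sz_gt0 HG _ Ga.
have l1 := link_lo t0 _ _ lk szg sza.
have l2 := link_hi t0 _ _ lk szg sza.
have eE := sigE disc0 (ty a); rewrite -[disc _](discC (tau:=tau)) ta negbK in eE.
exists (sz a).
  split; [exact: ltW|exact: le_g| |].
    rewrite -eE -mulrA ler_pM2l //= -ta.
    lra.
  rewrite -eE -mulrA ler_pM2l //= -ta; lra.
split.
- move=> h Gh th hx.
  have := spaced_lt h a Gh Ga (etrans th (esym ta)) (hx _ ap) => hA.
  apply: (le_trans hA); rewrite le_max; apply/orP; right.
  case/and3P: lk => _ + _; rewrite (min_idPr (le_g _ ap)); lra.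
- by [].
- by move=> b s' [-> _].
move=> h Gh lk' hp; apply: (linked_triple t0 HG) => //.
by move=> e; move: hp; rewrite e ap.
Qed.

Let maxk := Num.max (tau true) (tau false) - t.
(** The denominator in [phi]. *)
Let N c := disc c + 2 * (1 + t) ^+ 2 * (maxk + (1 + t)).

Lemma kap_maxk c : kap c <= maxk.
Proof. by rewrite /kap /maxk lerD2r le_max; case: c; rewrite lexx ?orbT. Qed.

(** [h] is the largest gap of the right path; [p1] leads from it to the facing end, [p2] to the far
    end. On the left, [g] is the first gap at least as large as [h] that is met when one walks away
    from the facing end, so [h] dominates every gap of [p]. *)
Section configuration.
Context {g h : gap} {p p1 p2 : seq gap}.
Hypotheses (pth : path link g p) (un : uniq (g :: p))
  (pth1 : path link h p1) (pth2 : path link h p2) (un12 : uniq (p1 ++ h :: p2))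
  (Gp : forall x, x \in g :: p -> G x) (Gh : forall x, x \in p1 ++ h :: p2 -> G x)
  (small : forall x, x \in p -> sz x < sz h) (hg : sz h <= sz g)
  (h_max : forall x, x \in p1 ++ h :: p2 -> sz x <= sz h)
  (sep : forall x y, x \in g :: p -> y \in p1 ++ h :: p2 -> hi x <= lo y)
  (unl : forall x y, x \in g :: p -> y \in p1 ++ h :: p2 -> ~~ link x y).

Let in1 x : x \in h :: p1 -> x \in p1 ++ h :: p2.
Proof. by rewrite mem_cat !inE => /orP[->|->]; rewrite ?orbT. Qed.
Let in2 x : x \in h :: p2 -> x \in p1 ++ h :: p2.
Proof. by rewrite mem_cat !inE => /orP[->|->]; rewrite ?orbT. Qed.
Let in1' x : x \in p1 -> x \in p1 ++ h :: p2.
Proof. by move=> ?; apply: in1; rewrite inE; apply/orP; right. Qed.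
Let in2' x : x \in p2 -> x \in p1 ++ h :: p2.
Proof. by move=> ?; apply: in2; rewrite inE; apply/orP; right. Qed.
Let inp x : x \in p -> x \in g :: p.
Proof. by rewrite inE => ->; rewrite orbT. Qed.
Let hin := in1 _ (mem_head h p1).
Let gin := mem_head g p.
Let un1 : uniq (h :: p1).
Proof.
move: un12; rewrite cat_uniq /= negb_or => /and3P[-> /andP[-> _] _] //.
Qed.
Let un2 : uniq (h :: p2). Proof. by move: un12; rewrite cat_uniq => /and3P[]. Qed.
Let dist := lo (last h p1) - hi (last g p).
Let span := hi (last h p2) - lo (last h p1).
Let Gg := Gp _ gin.
Let Ghh := Gh _ hin.
Let szg := sz_gt0 HG _ Gg.
Let szh := sz_gt0 HG _ Ghh.

(** The pair is [g] and [h]. Each side extends into the space between them by at most its [slam]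
    share of the distance, and [psi] is what is left. *)
Lemma span_le_dist_unlike : ty g != ty h ->
  exists L, [/\ 0 <= L, psi t (tau true) (tau false) * L <= dist &
                t * (disc (ty h) * span) <= N (ty h) * L].
Proof.
move=> tgh'.
have tgh : ty g = ~~ ty h by case: (ty g) tgh'; case: (ty h).
have thg : ty h = ~~ ty g by rewrite tgh negbK.
have L0 : 0 <= lo h - hi g by rewrite subr_ge0; apply: sep.
exists (lo h - hi g); split => //.
  have := ext_right g p h pth un Gp Ghh thg.
  move/(_ (fun x xp => sep x h xp hin)).
  move/(_ (fun x xp _ => le_trans (ltW (small x xp)) hg) (fun x xp _ => ltW (small x xp))).
  have := ext_left h p1 g pth1 un1 (fun x xp => Gh x (in1 _ xp)) Gg tgh.
  move/(_ (fun x xp => sep g x gin (in1 _ xp))).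
  move/(_ (fun x xp _ => h_max x (in1' _ xp))).
  move/(_ (fun x xp _ => le_trans (h_max x (in1' _ xp)) hg)).
  rewrite (psiE (ty h)) tgh /dist; lra.
have tgL := unlinked_gap _ _ Gg Ghh thg (sep _ _ gin hin) (unl _ _ gin hin).
rewrite (min_idPr hg) in tgL.
have [b [b0 bh _ eb] [bs _ _ _]] := branch_size h p1 pth1 un1 (fun x xp => Gh x (in1 _
  xp)) (fun x xp => h_max x (in1' _ xp)).
have [v [v0 vh ev _] [vs _ _ _]] := branch_size h p2 pth2 un2 (fun x xp => Gh x (in2 _
  xp)) (fun x xp => h_max x (in2' _ xp)).
have K u : 0 <= u -> u <= sz h -> hi g + tau (ty g) * Num.min (sz g) u <= Num.max (hi g)
  (hi h + t * u) -> kap (~~ ty h) * u <= lo h - hi g + sz h.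
  move=> u0 uh; rewrite (min_idPr (le_trans uh hg)) -tgh (tauE (t:=t) (tau:=tau)) le_max => /orP[|].
    rewrite gerDl => h0.
    have := mulr_ge0 (ltW (kap0 (ty g))) u0; have := mulr_ge0 (ltW t0) u0.
    have := ltW szh; lra.
  rewrite /sz; lra.
have kb := K b b0 bh (bs g Gg tgh (fun x xp => sep g x gin (in1' _ xp))).
have kv := K v v0 vh (vs g Gg tgh (fun x xp => sep g x gin (in2' _ xp))).
have extE : ext (~~ ty h) = (1 + t) * kap (~~ ty h) * (kap (ty h) + (1 + t)).
  by rewrite /ext negbK.
have := @span_unlike _ t (1 + t) (kap (ty h)) (kap (~~ ty h)) maxk (sz h) b v (lo h - hi
  g) (disc (ty h)) (ext (~~ ty h)) t0 erefl (kap0 _) (kap0 _) (disc0 _) extE (kap_maxk _)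
  (kap_maxk _) (ltW tgL) kb kv L0.
apply: le_trans; rewrite ler_pM2l // /span /sz; lra.
Qed.

(** [g] and [h] have equal types, so [h] is replaced by its facing neighbour [b], which is large
    enough to control [p]. The bridge from [g] to [h] bounds [L] from below. *)
Lemma span_le_dist_facing b s : p1 = b :: s -> ty g = ty h ->
  (forall x, x \in p -> ty x = ty b -> sz x <= sz b) ->
  exists L, [/\ 0 <= L, psi t (tau true) (tau false) * L <= dist &
                t * (disc (ty h) * span) <= N (ty h) * L].
Proof.
move=> p1E tgh le_b.
have lk : link h b by move: pth1; rewrite p1E => /= /andP[].
have tb : ty b = ~~ ty h := link_ty _ _ lk.
have tbg : ty b = ~~ ty g by rewrite tgh.
have tgb : ty g = ~~ ty b by rewrite tbg negbK.
have b1 : b \in p1 by rewrite p1E mem_head.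
have bin := in1' _ b1.
have Gb := Gh _ bin; have szb := sz_gt0 HG _ Gb.
have bs_p1 x : x \in b :: s -> x \in p1 by rewrite p1E.
have pths : path link b s by move: pth1; rewrite p1E => /= /andP[].
have uns : uniq (b :: s) by move: un1; rewrite p1E => /= /andP[].
have bh : sz b <= sz h := h_max _ bin.
have L0 : 0 <= lo b - hi g by rewrite subr_ge0; apply: sep.
exists (lo b - hi g); split => //.
  have := ext_right g p b pth un Gp Gb tbg.
  move/(_ (fun x xp => sep x b xp bin)).
  move/(_ (fun x xp _ => le_trans (ltW (small x xp)) hg) le_b).
  have same1 x : x \in p1 -> ty x = ty h -> sz x <= sz h by move=> xp _; apply: h_max; apply: in1'.
  have := neighbour_bound t0 kap0 disc0 HG h b s.
  rewrite -p1E => /(_ pth1 un1 (fun x xp => Gh x (in1 _ xp)) same1) nb.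
  have same x : x \in s -> ty x = ty b -> sz x <= sz b.
    move=> xs; have xp1 : x \in p1 by apply: bs_p1; rewrite inE xs orbT.
    by case: (nb _ xp1).
  have := ext_left b s g pths uns (fun x xp => Gh x (in1' _ (bs_p1 _ xp))) Gg tgb.
  move/(_ (fun x xp => sep g x gin (in1' _ (bs_p1 _ xp)))) => /(_ same).
  have other x : x \in s -> ty x = ty g -> sz x <= sz g.
    by move=> xs _; apply: le_trans hg; apply: h_max; apply: in1'; apply: bs_p1; rewrite
      inE xs orbT.
  move/(_ other).
  by rewrite (psiE (ty b)) -tgb /dist p1E /=; lra.
have tbL := unlinked_gap _ _ Gg Gb tbg (sep _ _ gin bin) (unl _ _ gin bin).
rewrite (min_idPr (le_trans bh hg)) in tbL.
have ghL := spaced_lt _ _ Gg Ghh tgh (sep _ _ gin hin).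
rewrite (min_idPr hg) tgh (tauE (t:=t) (tau:=tau)) in ghL.
have lb := link_lo t0 _ _ lk szh szb.
have [b' [_ _ _ eb] [_ _ bE _]] := branch_size h p1 pth1 un1 (fun x xp => Gh x (in1 _
  xp)) (fun x xp => h_max x (in1' _ xp)).
rewrite (bE _ _ p1E) in eb.
have [v [v0 vh ev _] [_ _ _ vb]] := branch_size h p2 pth2 un2 (fun x xp => Gh x (in2 _
  xp)) (fun x xp => h_max x (in2' _ xp)).
have bN2 : b \notin p2.
  move: un12; rewrite cat_uniq => /and3P[_ /hasPn dis _]; apply/negP => bp2.
  by have := dis b; rewrite inE bp2 orbT b1 => /(_ isT).
have := vb b Gb; rewrite linkC lk tb => /(_ isT bN2) kbv.
have kor : kap (~~ ty h) * sz b <= (1 + t) * sz h \/ kap (~~ ty h) * v <= (1 + t) * sz h.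
  by move: kbv; case: (leP (sz b) v) => _ ?; [left|right].
have extE : ext (~~ ty h) = (1 + t) * kap (~~ ty h) * (kap (ty h) + (1 + t)).
  by rewrite /ext negbK.
have hL : (kap (ty h) + t) * sz h - (1 + t) * sz b <= lo b - hi g by lra.
have := @span_facing _ t (1 + t) (kap (ty h)) (kap (~~ ty h)) maxk (sz h) (sz b) v (lo b
  - hi g) (disc (ty h)) (ext (~~ ty h)) t0 erefl (kap0 _) (kap0 _) (disc0 _) erefl extE
  (kap_maxk _) (kap_maxk _) szh bh vh kor (ltW tbL) hL.
apply: le_trans; rewrite ler_pM2l // /span {1}/sz; lra.
Qed.

(** Here the neighbour [a] of [g] replaces [g] in the pair. The facing extension of [h] is bounded
    by its first gap and also, through [slam], by [L]. *)
Lemma span_le_dist_away a s : p = a :: s -> ty g = ty h ->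
  (forall x, x \in p1 -> ty x = ty a -> sz x <= sz a) ->
  exists L, [/\ 0 <= L, psi t (tau true) (tau false) * L <= dist &
                t * (disc (ty h) * span) <= N (ty h) * L].
Proof.
move=> pE tgh le_a.
have lk : link g a by move: pth; rewrite pE => /= /andP[].
have ta : ty a = ~~ ty h by rewrite -tgh (link_ty _ _ lk).
have tha : ty h = ~~ ty a by rewrite ta negbK.
have ap : a \in p by rewrite pE mem_head.
have ain := inp _ ap.
have Ga := Gp _ ain; have sza := sz_gt0 HG _ Ga.
have as_p x : x \in a :: s -> x \in p by rewrite pE.
have s_p x : x \in s -> x \in p by move=> xs; apply: as_p; rewrite inE xs orbT.
have pths : path link a s by move: pth; rewrite pE => /= /andP[].
have uns : uniq (a :: s) by move: un; rewrite pE => /= /andP[].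
have ah : sz a < sz h := small _ ap.
have L0 : 0 <= lo h - hi a by rewrite subr_ge0; apply: sep.
have le_h1 : lo h - slam (ty a) * (lo h - hi a) <= lo (last h p1).
  have := ext_left h p1 a pth1 un1 (fun x xp => Gh x (in1 _ xp)) Ga ta.
  move/(_ (fun x xp => sep a x ain (in1 _ xp))).
  by move/(_ (fun x xp _ => h_max x (in1' _ xp)) le_a).
exists (lo h - hi a); split => //.
  have same0 x : x \in p -> ty x = ty g -> sz x <= sz g.
    by move=> xp _; apply: le_trans hg; apply/ltW/small.
  have := neighbour_bound t0 kap0 disc0 HG g a s.
  rewrite -pE => /(_ pth un Gp same0) nb.
  have same x : x \in s -> ty x = ty a -> sz x <= sz a.
    by move=> xs; case: (nb _ (s_p _ xs)).
  have := ext_right a s h pths uns (fun x xp => Gp x (inp _ (as_p _ xp))) Ghh tha.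
  move/(_ (fun x xp => sep x h (inp _ (as_p _ xp)) hin)) => /(_ same).
  move/(_ (fun x xp _ => ltW (small x (s_p _ xp)))).
  by rewrite (psiE (ty a)) -tha /dist pE /=; lra.
have taL := unlinked_gap _ _ Ga Ghh tha (sep _ _ ain hin) (unl _ _ ain hin).
rewrite (min_idPl (ltW ah)) in taL.
have ghL := spaced_lt _ _ Gg Ghh tgh (sep _ _ gin hin).
rewrite (min_idPr hg) tgh (tauE (t:=t) (tau:=tau)) in ghL.
have lb := link_hi t0 _ _ lk szg sza.
have [b [b0 bh _ eb] [_ b_nil bE _]] := branch_size h p1 pth1 un1 (fun x xp => Gh x (in1
  _ xp)) (fun x xp => h_max x (in1' _ xp)).
have [v [v0 vh ev _] [va _ _ vb]] := branch_size h p2 pth2 un2 (fun x xp => Gh x (in2 _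
  xp)) (fun x xp => h_max x (in2' _ xp)).
have {}va := va a Ga ta (fun x xp => sep a x ain (in2' _ xp)).
have hmin : 0 <= Num.min (sz a) v by rewrite le_min v0 ltW.
have kav : (kap (~~ ty h) + t) * Num.min (sz a) v <= lo h - hi a + sz h + t * v.
  move: va; rewrite ta (tauE (t:=t) (tau:=tau)) le_max => /orP[|].
    rewrite gerDl => h0.
    have := mulr_ge0 (ltW t0) v0; have := ltW szh; lra.
  rewrite /sz; lra.
have extE : ext (~~ ty h) = (1 + t) * kap (~~ ty h) * (kap (ty h) + (1 + t)).
  by rewrite /ext negbK.
pose e := disc (ty h) * (lo h - lo (last h p1)).
have eL : kap (~~ ty h) * e <= ext (~~ ty h) * (lo h - hi a).
  apply: le_trans (ext_slam (~~ ty h) _ L0).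
  rewrite ler_pM2l // [disc (~~ _)]discC ler_pM2l // -ta; lra.
have hL : (kap (ty h) + t) * sz h - (1 + t) * sz a <= lo h - hi a by lra.
have ba_kbv : b <= sz a /\ kap (~~ ty h) * Num.min b v <= (1 + t) * sz h.
  case: p1 b_nil bE pth1 le_a un12 Gh => [|b1 s1] b_nil bE /= pth1' le_a' un12' Gh'.
    rewrite b_nil // (min_idPl v0) mulr0; split; first exact: ltW.
    by apply: mulr_ge0; [rewrite addr_ge0 // ltW|exact: ltW].
  have /andP[lk1 _] := pth1'.
  have tb1 := link_ty _ _ lk1.
  rewrite (bE _ _ erefl); split; first by apply: le_a'; rewrite ?mem_head // tb1 ta.
  rewrite -tb1; apply: vb; rewrite 1?linkC //; first by apply: Gh'; rewrite mem_head.
  by move: un12' => /= /andP[]; rewrite mem_cat inE !negb_or => /and3P[].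
case: ba_kbv => ba kbv.
have := @span_away _ t (1 + t) (kap (ty h)) (kap (~~ ty h)) maxk (sz h) b v (sz a) e (lo
  h - hi a) (disc (ty h)) (ext (~~ ty h)) t0 erefl (kap0 _) (kap0 _) (disc0 _) erefl extE
  (kap_maxk _) (kap_maxk _) szh ba (ltW sza) (ltW ah) vh eb eL (ltW taL) hL kav kbv.
apply: le_trans; rewrite ler_pM2l // /e /span /sz; lra.
Qed.

(** Nothing extends into the space between two gaps of equal type, so the pair [g], [h] is used
    although its types agree; [b = 0] stands for the missing neighbour. *)
Lemma span_le_dist_bare : p = [::] -> p1 = [::] -> ty g = ty h ->
  exists L, [/\ 0 <= L, psi t (tau true) (tau false) * L <= dist &
                t * (disc (ty h) * span) <= N (ty h) * L].
Proof.
move=> pE p1E tgh.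
have L0 : 0 <= lo h - hi g by rewrite subr_ge0; apply: sep.
exists (lo h - hi g); split => //.
  rewrite /dist pE p1E /= (psiE true) -[leRHS]mul1r ler_wpM2r //.
  have := slam_ge0 true; have := slam_ge0 (~~ true); lra.
have ghL := spaced_lt _ _ Gg Ghh tgh (sep _ _ gin hin).
rewrite (min_idPr hg) tgh (tauE (t:=t) (tau:=tau)) in ghL.
have [v [v0 vh ev _] _] := branch_size h p2 pth2 un2 (fun x xp => Gh x (in2 _ xp)) (fun
  x xp => h_max x (in2' _ xp)).
have extE : ext (~~ ty h) = (1 + t) * kap (~~ ty h) * (kap (ty h) + (1 + t)).
  by rewrite /ext negbK.
have kor : kap (~~ ty h) * 0 <= (1 + t) * sz h \/ kap (~~ ty h) * v <= (1 + t) * sz h.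
  by left; rewrite mulr0; apply: mulr_ge0; [rewrite addr_ge0 // ltW|exact: ltW].
have tL : t * 0 <= lo h - hi g by rewrite mulr0.
have hL : (kap (ty h) + t) * sz h - (1 + t) * 0 <= lo h - hi g by rewrite mulr0; lra.
have := @span_facing _ t (1 + t) (kap (ty h)) (kap (~~ ty h)) maxk (sz h) 0 v (lo h - hi
  g) (disc (ty h)) (ext (~~ ty h)) t0 erefl (kap0 _) (kap0 _) (disc0 _) erefl extE
  (kap_maxk _) (kap_maxk _) szh (ltW szh) vh kor tL hL.
apply: le_trans; rewrite ler_pM2l // /span p1E /= /sz; lra.
Qed.

Lemma span_le_dist : phi t (tau true) (tau false) * span <= dist.
Proof.
have [L [L0 psiL sL]] : exists L, [/\ 0 <= L, psi t (tau true) (tau false) * L <= dist &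
                t * (disc (ty h) * span) <= N (ty h) * L].
  have [tgh|] := eqVneq (ty g) (ty h); last exact: span_le_dist_unlike.
  have [[a [s pE]]|pE] : (exists a s, p = a :: s) \/ p = [::].
    by case: (p) => [|a s]; [right|left; exists a, s].
  - have lk : link g a by move: pth; rewrite pE => /= /andP[].
    have same0 x : x \in p -> ty x = ty g -> sz x <= sz g.
      by move=> xp _; apply: le_trans hg; apply/ltW/small.
    have := neighbour_bound t0 kap0 disc0 HG g a s.
    rewrite -pE => /(_ pth un Gp same0) nba.
    have [[b [s1 p1E]]|p1E] : (exists b s, p1 = b :: s) \/ p1 = [::].
      by case: (p1) => [|b s1]; [right|left; exists b, s1].
    + have lkb : link h b by move: pth1; rewrite p1E => /= /andP[].
      have same1 x : x \in p1 -> ty x = ty h -> sz x <= sz h.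
        by move=> xp _; apply: h_max; apply: in1'.
      have := neighbour_bound t0 kap0 disc0 HG h b s1.
      rewrite -p1E => /(_ pth1 un1 (fun x xp => Gh x (in1 _ xp)) same1) nbb.
      have tab : ty a = ty b by rewrite (link_ty _ _ lk) (link_ty _ _ lkb) tgh.
      (* The larger of the two neighbours enters the pair: it dominates all the gaps of its type on
         the opposite path. *)
      have [ab|ba] := leP (sz a) (sz b).
        apply: (span_le_dist_facing b s1) => // x xp tx.
        by apply: le_trans ab; case: (nba x xp) => _ _; apply; rewrite tab.
      apply: (span_le_dist_away a s) => // x xp tx.
      by apply: le_trans (ltW ba); case: (nbb x xp) => _ _; apply; rewrite -tab.
    + by apply: (span_le_dist_away a s) => //; rewrite p1E.
  - have [[b [s1 p1E]]|p1E] : (exists b s, p1 = b :: s) \/ p1 = [::].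
      by case: (p1) => [|b s1]; [right|left; exists b, s1].
    + by apply: (span_le_dist_facing b s1) => //; rewrite pE.
    + exact: span_le_dist_bare.
have dh := disc0 (ty h).
have m0 : 0 < maxk by apply: lt_le_trans (kap_maxk (ty h)).
have Npos : 0 < N (ty h).
  rewrite /N; apply: addr_gt0 => //; apply: mulr_gt0.
    by rewrite mulr_gt0 // exprn_gt0 // addr_gt0.
  by apply: addr_gt0 => //; exact: addr_gt0.
have dE : disc (ty h) = disc true by case: (ty h) => //; rewrite -(discC true).
have phiE : phi t (tau true) (tau false) =
    psi t (tau true) (tau false) * (t * disc (ty h)) / N (ty h).
  have -> : N (ty h) = N true by rewrite /N dE.
  rewrite dE /phi.
  have -> : (tau true - t) * (tau false - t) + (1 + t) ^+ 2 * (2 * Num.max (tau true)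
    (tau false) + 1) = N true.
    by rewrite /N /disc /kap /maxk /=; set M := Num.max _ _; ring.
  have -> : (tau true - t) * (tau false - t) - (1 + t) ^+ 2 = disc true by [].
  by ring.
apply: le_trans psiL.
rewrite phiE mulrAC -mulrA -mulrA ler_pM2l // mulrA ler_pdivrMr //.
by rewrite [leRHS]mulrC -mulrA.
Qed.
End configuration.
End main_estimate.

(** * Connected components of the link graph *)

Lemma exists_max {T : eqType} {R : realType} (f : T -> R) (x : T) (s : seq T) :
  exists2 h, h \in x :: s & forall y, y \in x :: s -> f y <= f h.
Proof.
elim: s x => [|z s IH] x.
  by exists x; rewrite ?mem_head // => y; rewrite inE => /eqP ->.
have [h hin hmax] := IH z.
have [xh|hx] := leP (f x) (f h).
  exists h; first by rewrite inE hin orbT.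
  by move=> y; rewrite inE => /orP[/eqP -> //|/hmax].
exists x; first by rewrite mem_head.
move=> y; rewrite inE => /orP[/eqP -> //|/hmax yh].
exact: le_trans yh (ltW hx).
Qed.

Lemma head_rev_cat {T : Type} (x g : T) (s p1 p2 : seq T) :
  x :: s = rev p1 ++ g :: p2 -> last g p1 = x /\ last g p2 = last x s.
Proof.
move=> e; split.
  by case/lastP: p1 e => [|p1 y]; rewrite ?last_rcons ?rev_rcons => -[].
have := congr1 (last x) e; rewrite /= last_cat /= => <-.
by [].
Qed.

Lemma path_rev_cat {T : eqType} (e : rel T) (x g : T) (s p1 p2 : seq T) :
  symmetric e -> path e x s -> x :: s = rev p1 ++ g :: p2 ->
  path e g p1 /\ path e g p2.
Proof.
move=> eC; rewrite -[path e x s]/(sorted e (x :: s)) => + E; rewrite E => st.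
split; last by case/cat_sorted2: st => _.
have : sorted e (rev (g :: p1)).
  by move: st; rewrite -cat1s catA cats1 -rev_cons => /cat_sorted2[].
rewrite rev_sorted /=; congr (is_true _); apply: eq_path => u v; exact: eC.
Qed.

Section connection.
Context {R : realType} {t : R} {tau : bool -> R}.
Hypothesis t0 : 0 < t.
Hypothesis kap0 : forall c, 0 < kap (t:=t) (tau:=tau) c.
Hypothesis disc0 : forall c, 0 < disc (t:=t) (tau:=tau) c.
Hypothesis psi0 : 0 < psi t (tau true) (tau false).
Notation link := (link (t:=t)).
Notation gap := (gap (R:=R)).
Notation phi0 := (phi t (tau true) (tau false)).

(** [x] and [y] are the facing ends. The right path is cut at its largest gap, the left one at the
    first gap at least as large, which exists by the last hypothesis. *)
Lemma span_right_le_dist (G : set gap) x sx y sy : spaced (tau:=tau) G ->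
  path link x sx -> uniq (x :: sx) -> path link y sy -> uniq (y :: sy) ->
  (forall z, z \in x :: sx -> G z) -> (forall z, z \in y :: sy -> G z) ->
  (forall u v, u \in x :: sx -> v \in y :: sy -> hi u <= lo v) ->
  (forall u v, u \in x :: sx -> v \in y :: sy -> ~~ link u v) ->
  (exists2 u, u \in x :: sx & forall v, v \in y :: sy -> sz v <= sz u) ->
  phi0 * (hi (last y sy) - lo y) <= lo y - hi x.
Proof.
move=> HG px ux py uy Gx Gy sep unl [z zx zmax].
have [h hy hmax] := exists_max (sz (R:=R)) y sy.
have hasz : has (fun u => sz h <= sz u) (x :: sx) by apply/hasP; exists z => //; exact: zmax.
have [q1 [q2 yE]] : exists q1 q2, y :: sy = q1 ++ h :: q2.
  by have /splitPr[q1 q2] := hy; exists q1, q2.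
have [g [s1 [s2 [xE hg small]]]] : exists g s1 s2,
   [/\ x :: sx = s1 ++ g :: s2, sz h <= sz g & forall u, u \in s1 -> sz u < sz h].
  case: (split_find hasz) => g s1 s2 hg /hasPn sm.
  exists g, s1, s2; split => //; first by rewrite cat_rcons.
  by move=> u /sm; rewrite -ltNge.
rewrite -[q1]revK in yE; rewrite -[s1]revK in xE.
have [py1 py2] := path_rev_cat _ _ _ _ _ _ (linkC (t:=t)) py yE.
have [px1 _] := path_rev_cat _ _ _ _ _ _ (linkC (t:=t)) px xE.
have [ly1 ly2] := head_rev_cat _ _ _ _ _ yE.
have [lx1 _] := head_rev_cat _ _ _ _ _ xE.
rewrite !revK in xE yE.
rewrite -ly2 -ly1 -lx1.
have sub1 u : u \in g :: rev s1 -> u \in x :: sx.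
  by rewrite xE inE mem_rev mem_cat inE => /orP[->|->]; rewrite ?orbT.
have sub2 u : u \in rev q1 ++ h :: q2 -> u \in y :: sy.
  by rewrite yE !mem_cat mem_rev.
apply: (span_le_dist t0 kap0 disc0 psi0 HG px1 _ py1 py2) => //.
- move: ux; rewrite xE -cat_rcons cat_uniq => /andP[u1 _].
  by rewrite -rev_rcons rev_uniq.
- have pq : perm_eq (rev q1 ++ h :: q2) (q1 ++ h :: q2) by rewrite perm_cat2r perm_rev.
  by rewrite (perm_uniq pq) -yE.
- by move=> u /sub1; apply: Gx.
- by move=> u /sub2; apply: Gy.
- by move=> u; rewrite mem_rev; apply: small.
- by move=> u /sub2; apply: hmax.
- by move=> u v /sub1 ? /sub2 ?; apply: sep.
- by move=> u v /sub1 ? /sub2 ?; apply: unl.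
Qed.

Definition mirror (g : gap) : gap := (ty g, - hi g, - lo g).

Lemma mirrorK : involutive mirror.
Proof. by case=> [[c l] r]; rewrite /mirror /ty /hi /lo /= !opprK. Qed.

Lemma sz_mirror g : sz (mirror g) = sz g.
Proof. by rewrite /sz /mirror /hi /lo /= opprK addrC. Qed.

Lemma link_mirror x y : link (mirror x) (mirror y) = link x y.
Proof.
rewrite /link !sz_mirror /mirror /ty /hi /lo /= !opprK.
by rewrite [- y.2 + _]addrC [- x.2 + _]addrC; congr andb; rewrite andbC.
Qed.

Lemma spaced_mirror (G : set gap) : spaced (tau:=tau) G ->
  spaced (tau:=tau) [set g | G (mirror g)].
Proof.
move=> HG; split=> [x /(HG.1) /=|x y Gx Gy txy xy].
  by rewrite /mirror /hi /lo /= ltrN2.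
have ne : mirror x <> mirror y by move=> /(congr1 mirror); rewrite !mirrorK.
case: (HG.2 _ _ Gx Gy txy ne).
- by rewrite !sz_mirror /mirror /hi /lo /ty /=; right; lra.
- by rewrite !sz_mirror /mirror /hi /lo /ty /=; left; lra.
Qed.

(** The reflection at the origin exchanges the roles of the two components. *)
Lemma span_left_le_dist (G : set gap) x sx y sy : spaced (tau:=tau) G ->
  path link x sx -> uniq (x :: sx) -> path link y sy -> uniq (y :: sy) ->
  (forall z, z \in x :: sx -> G z) -> (forall z, z \in y :: sy -> G z) ->
  (forall u v, u \in x :: sx -> v \in y :: sy -> hi u <= lo v) ->
  (forall u v, u \in x :: sx -> v \in y :: sy -> ~~ link u v) ->
  (exists2 u, u \in y :: sy & forall v, v \in x :: sx -> sz v <= sz u) ->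
  phi0 * (hi x - lo (last x sx)) <= lo y - hi x.
Proof.
move=> HG px ux py uy Gx Gy sep unl [z zy zmax].
have mir z' s' w : z' \in map mirror (w :: s') -> exists2 u, u \in w :: s' & z' = mirror u.
  by move=> /mapP[u us ->]; exists u.
have pm u s : path link u s -> path link (mirror u) (map mirror s).
  by rewrite path_map; congr (is_true _); apply: eq_path => ? ?; rewrite /= link_mirror.
have um s : uniq s -> uniq (map mirror s).
  by rewrite map_inj_uniq //; apply: can_inj mirrorK.
have := span_right_le_dist _ _ _ _ _ (spaced_mirror _ HG) (pm _ _ py) (um _ uy) (pm _ _
  px) (um _ ux).
have -> : last (mirror x) (map mirror sx) = mirror (last x sx) by rewrite last_map.
have -> : hi (mirror (last x sx)) - lo (mirror x) = hi x - lo (last x sx).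
  by rewrite /mirror /hi /lo /= opprK addrC.
have -> : lo (mirror x) - hi (mirror y) = lo y - hi x.
  by rewrite /mirror /hi /lo /= opprK addrC.
apply.
- by move=> z' /mir[u uy' ->]; rewrite /= mirrorK; apply: Gy.
- by move=> z' /mir[u uy' ->]; rewrite /= mirrorK; apply: Gx.
- move=> u v /mir[u' us ->] /mir[v' vs ->].
  by rewrite /mirror /hi /lo /= lerN2; apply: sep.
- move=> u v /mir[u' us ->] /mir[v' vs ->]; rewrite link_mirror linkC; exact: unl.
- exists (mirror z); first by rewrite -map_cons map_f.
  by move=> v /mir[v' vs ->]; rewrite !sz_mirror; apply: zmax.
Qed.

Context {G : set gap} (HG : spaced (tau:=tau) G).

Definition conn (x y : gap) :=
  exists s, [/\ path link x s, last x s = y & forall z, z \in x :: s -> G z].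

Lemma conn_G x y : conn x y -> G x /\ G y.
Proof.
by case=> s [_ <- GG]; split; apply: GG; rewrite ?mem_head ?mem_last.
Qed.

Lemma conn_refl x : G x -> conn x x.
Proof. by move=> Gx; exists [::]; split => // z; rewrite inE => /eqP ->. Qed.

Lemma conn_trans y x z : conn x y -> conn y z -> conn x z.
Proof.
case=> s [ps <- Gs] [s' [ps' <- Gs']]; exists (s ++ s'); split.
- by rewrite cat_path ps.
- by rewrite last_cat.
- move=> w; rewrite -cat_cons mem_cat => /orP[/Gs //|ws]; apply: Gs'.
  by rewrite inE ws orbT.
Qed.

Lemma conn_link x y : G x -> G y -> link x y -> conn x y.
Proof.
move=> Gx Gy xy; exists [:: y]; split; rewrite /= ?xy //.
by move=> z; rewrite !inE => /orP[] /eqP ->.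
Qed.

Lemma conn_sym x y : conn x y -> conn y x.
Proof.
case=> s; elim: s x => [|z s IH] x [ps ly Gs].
  by rewrite -ly; apply: conn_refl; apply: Gs; rewrite mem_head.
move: ps => /= /andP[xz ps].
have Gz : G z by apply: Gs; rewrite !inE eqxx orbT.
have Gx : G x by apply: Gs; rewrite mem_head.
apply: (conn_trans z); last by apply: conn_link => //; rewrite linkC.
by apply: IH; split => // w ws; apply: Gs; rewrite inE ws orbT.
Qed.

Lemma conn_uniq x y : conn x y -> exists s, [/\ path link x s, uniq (x :: s), last x s = y
   & forall z, z \in x :: s -> conn x z].
Proof.
move=> [s [ps <- Gs]]; case/shortenP: ps (Gs) => s' ps' us' sub GG.
exists s'; split => // z zs.
have [zx|zs'] := eqVneq z x.
  by rewrite zx; apply: conn_refl; apply: GG; rewrite mem_head.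
move: zs; rewrite inE (negPf zs') /= => zs.
case/splitPr: zs ps' sub {us'} => s1 s2; rewrite cat_path => /andP[p1 /= /andP[p2 _]] sub.
exists (rcons s1 z); split; rewrite ?rcons_path ?p1 ?last_rcons // => w.
rewrite inE => /orP[/eqP ->|ws]; apply: GG; rewrite ?mem_head // inE; apply/orP; right.
by apply: sub; move: ws; rewrite mem_rcons inE mem_cat inE => /orP[->|->]; rewrite ?orbT.
Qed.

Lemma disjoint_gaps x y : G x -> G y -> x <> y -> ~~ link x y -> hi x <= lo y \/ hi y <= lo x.
Proof.
move=> Gx Gy xy; have m0 := minsz_gt0 HG _ _ Gx Gy.
have [txy _|txy] := eqVneq (ty x) (ty y).
  have ta : 0 < tau (ty x).
    by have := kap0 (ty x); have := t0; rewrite /kap; lra.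
  by have := mulr_gt0 ta m0; case: (HG.2 x y Gx Gy txy xy); [left|right]; lra.
have := mulr_gt0 t0 m0.
by rewrite /link txy /= negb_and -!ltNge => ? /orP[]; [left|right]; lra.
Qed.

Lemma tau_gt c : t < tau c.
Proof. by have := kap0 c; rewrite /kap subr_gt0. Qed.

(** Unlinked gaps are further apart than [t] times the smaller size, also for equal types since
    [tau] exceeds [t]. Within [t * sz g] of [g], the smaller one can only be [h]. *)
Lemma far_right g h : G g -> G h -> hi g <= lo h -> ~~ link g h ->
  lo h - hi g <= t * sz g -> t * sz h < lo h - hi g.
Proof.
move=> Gg Gh gh unl d.
have sg := sz_gt0 HG _ Gg; have sh := sz_gt0 HG _ Gh.
have key : t * Num.min (sz g) (sz h) < lo h - hi g.
  have [tgh|tgh] := eqVneq (ty g) (ty h).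
    have := spaced_lt t0 kap0 HG _ _ Gg Gh tgh gh.
    have : t * Num.min (sz g) (sz h) < tau (ty g) * Num.min (sz g) (sz h).
      by rewrite ltr_pM2r ?tau_gt // (minsz_gt0 HG).
    lra.
  apply: (unlinked_gap t0 HG) => //.
  by case: (ty g) tgh; case: (ty h).
by move: key; case: (leP (sz g) (sz h)) => // _; lra.
Qed.

Lemma far_left g h : G g -> G h -> hi h <= lo g -> ~~ link g h ->
  lo g - hi h <= t * sz g -> t * sz h < lo g - hi h.
Proof.
move=> Gg Gh gh unl d.
have sg := sz_gt0 HG _ Gg; have sh := sz_gt0 HG _ Gh.
have key : t * Num.min (sz h) (sz g) < lo g - hi h.
  have [tgh|tgh] := eqVneq (ty h) (ty g).
    have := spaced_lt t0 kap0 HG _ _ Gh Gg tgh gh.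
    have : t * Num.min (sz h) (sz g) < tau (ty h) * Num.min (sz h) (sz g).
      by rewrite ltr_pM2r ?tau_gt // (minsz_gt0 HG).
    lra.
  apply: (unlinked_gap t0 HG) => //; last by rewrite linkC.
  by case: (ty h) tgh; case: (ty g).
by move: key; case: (leP (sz h) (sz g)) => // _; lra.
Qed.

(* A component that enters the space between two linked gaps of another
   component cannot leave it. *)
Lemma trapped g1 g2 h h' : link g1 g2 -> G g1 -> G g2 -> hi g1 <= lo h -> hi h <= lo g2 ->
  ~ conn g1 h -> conn h h' -> hi g1 <= lo h' /\ hi h' <= lo g2.
Proof.
move=> lk Gg1 Gg2 + + + [s [ps <- Gs]].
elim: s h ps Gs => [|h2 s IH] h //= /andP[lk2 ps] Gs g1h hg2 nc.
have Gh : G h by apply: Gs; rewrite mem_head.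
have Gh2 : G h2 by apply: Gs; rewrite !inE eqxx orbT.
have nlk1 x : conn g1 x -> ~~ link x h.
  move=> cx; apply/negP => l; apply: nc; apply: (conn_trans _ _ _ cx).
  by apply: conn_link => //; case: (conn_G _ _ cx).
have c1 := conn_refl _ Gg1; have c2 := conn_link _ _ Gg1 Gg2 lk.
have nc2 : ~ conn g1 h2.
  by move=> c; apply: nc; apply: (conn_trans _ _ _ c); apply: conn_link => //; rewrite linkC.
apply: IH => //.
- by move=> z zs; apply: Gs; rewrite inE zs orbT.
- have dj1 x : conn g1 x -> hi x <= lo h2 \/ hi h2 <= lo x.
    move=> cx; have [_ Gx] := conn_G _ _ cx.
    apply: disjoint_gaps => //; first by move=> e; apply: nc2; rewrite -e.
    apply/negP => l; apply: nc2; apply: (conn_trans _ _ _ cx); exact: conn_link.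
  have sh := sz_gt0 HG _ Gh; have s1 := sz_gt0 HG _ Gg1; have s2 := sz_gt0 HG _ Gg2.
  have [l12 l21 l22] := and3P lk.
  (* Since [g1] and [g2] are linked, [h] is within [t * sz g1] of [g1]. It is therefore too small
     for a link starting from it to reach past [g1]. *)
  have f1 : t * sz h < lo h - hi g1.
    apply: far_right => //; first exact: nlk1.
    have : t * Num.min (sz g1) (sz g2) <= t * sz g1 by rewrite ler_pM2l // ge_min lexx.
    rewrite /sz in sh *; lra.
  have [_ m1 m2] := and3P lk2.
  have m3 : t * Num.min (sz h) (sz h2) <= t * sz h by rewrite ler_pM2l // ge_min lexx.
  case: (dj1 _ c1) => // d.
  have := HG.1 _ Gg1; lra.
- have dj1 x : conn g1 x -> hi x <= lo h2 \/ hi h2 <= lo x.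
    move=> cx; have [_ Gx] := conn_G _ _ cx.
    apply: disjoint_gaps => //; first by move=> e; apply: nc2; rewrite -e.
    apply/negP => l; apply: nc2; apply: (conn_trans _ _ _ cx); exact: conn_link.
  have sh := sz_gt0 HG _ Gh; have s1 := sz_gt0 HG _ Gg1; have s2 := sz_gt0 HG _ Gg2.
  have [l12 l21 l22] := and3P lk.
  have f1 : t * sz h < lo g2 - hi h.
    apply: far_left => //; first exact: nlk1.
    have : t * Num.min (sz g1) (sz g2) <= t * sz g2 by rewrite ler_pM2l // ge_min lexx orbT.
    rewrite /sz in sh *; lra.
  have [_ m1 m2] := and3P lk2.
  have m3 : t * Num.min (sz h) (sz h2) <= t * sz h by rewrite ler_pM2l // ge_min lexx.
  case: (dj1 _ c2) => // d.
  have := HG.1 _ Gg2; lra.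
Qed.

(** A discrete intermediate value argument: each gap of the path lies on one side of [h], so two
    consecutive ones lie on different sides. *)
Lemma straddled X Y h : conn X Y -> G h -> ~ conn X h -> hi X <= lo h -> hi h <= lo Y ->
  exists g1 g2, [/\ conn X g1, conn X g2, link g1 g2, hi g1 <= lo h & hi h <= lo g2].
Proof.
move=> [s [ps <- Gs]] Gh; elim: s X ps Gs => [|Z s IH] X /=.
  move=> _ Gs _ Xh hX; have GX : G X by apply: Gs; rewrite mem_head.
  by have := HG.1 _ Gh; have := HG.1 _ GX; lra.
move=> /andP[XZ ps] Gs nc Xh hY.
have GX : G X by apply: Gs; rewrite mem_head.
have GZ : G Z by apply: Gs; rewrite !inE eqxx orbT.
have cXZ := conn_link _ _ GX GZ XZ.
have ncZ : ~ conn Z h by move=> c; apply: nc; exact: conn_trans cXZ c.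
have [Zh|hZ] : hi Z <= lo h \/ hi h <= lo Z.
  apply: disjoint_gaps => //; first by move=> e; apply: nc; rewrite -e.
  by apply/negP => l; apply: ncZ; apply: conn_link.
have [|g1 [g2 [a b c d e]]] := IH Z ps _ ncZ Zh hY.
  by move=> z zs; apply: Gs; rewrite inE zs orbT.
by exists g1, g2; split => //; exact: (conn_trans _ _ _ cXZ).
by exists X, Z; split => //; exact: conn_refl.
Qed.

(** Both points lie in the open hull of one component. The two witnesses avoid forming the hull of a
    possibly infinite component; [covered x x] says that [x] is removed. *)
Definition covered (x y : R) := exists X Y,
  conn X Y /\ [/\ lo X < x, lo X < y, x < hi Y & y < hi Y].

Lemma coveredC x y : covered x y -> covered y x.
Proof. by move=> [X [Y [c [? ? ? ?]]]]; exists X, Y. Qed.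

Lemma covered_pick X1 X2 Y1 Y2 x z : conn X1 Y1 -> conn X2 Y2 -> conn X1 X2 ->
  (lo X1 < x \/ lo X2 < x) -> (lo X1 < z \/ lo X2 < z) ->
  (x < hi Y1 \/ x < hi Y2) -> (z < hi Y1 \/ z < hi Y2) -> covered x z.
Proof.
move=> c1 c2 c12 l1 l2 r1 r2.
pose X := if lo X1 <= lo X2 then X1 else X2.
pose Y := if hi Y1 <= hi Y2 then Y2 else Y1.
have cX : conn X1 X by rewrite /X; case: ifP => // _; apply: conn_refl; case: (conn_G _ _ c1).
have cY : conn X1 Y by rewrite /Y; case: ifP => // _; exact: conn_trans c12 c2.
have hX : lo X <= lo X1 /\ lo X <= lo X2.
  by rewrite /X; case: (leP (lo X1) (lo X2)) => ?; split; lra.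
have hY : hi Y1 <= hi Y /\ hi Y2 <= hi Y.
  by rewrite /Y; case: (leP (hi Y1) (hi Y2)) => ?; split; lra.
exists X, Y; split; first exact: conn_trans (conn_sym _ _ cX) cY.
case: hX hY => ? ? [? ?].
split; [case: l1|case: l2|case: r1|case: r2]; lra.
Qed.

(** The hulls of different components are disjoint or nested: if they share [y], the one that starts
    further right enters between two linked gaps of the other and is trapped there. *)
Lemma covered_trans y x z : covered x y -> covered y z -> covered x z.
Proof.
suff main X Y X' Y' a b : lo X <= lo X' -> conn X Y -> conn X' Y' ->
    lo X < a -> a < hi Y -> lo X < y -> y < hi Y -> lo X' < y -> y < hi Y' ->
    lo X' < b -> b < hi Y' -> covered a b.
  move=> [X [Y [c [l1 l2 l3 l4]]]] [X' [Y' [c' [r1 r2 r3 r4]]]].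
  have [XX|XX] := leP (lo X) (lo X').
    exact: (main X Y X' Y').
  by apply: coveredC; apply: (main X' Y' X Y) => //; exact: ltW.
move=> XX c c' a1 a2 y1 y2 y3 y4 b1 b2.
have [cX|nc] := pselect (conn X X').
  by apply: (covered_pick X X' Y Y') => //; [left|right|left|right].
have [GX GY] := conn_G _ _ c; have [GX' GY'] := conn_G _ _ c'.
have d1 : hi X' <= lo Y.
  case: (disjoint_gaps X' Y) => //; last by lra.
    by move=> e; apply: nc; rewrite e.
  apply/negP => l; apply: nc; apply: (conn_trans _ _ _ c); apply: conn_link => //.
  by rewrite linkC.
have d2 : hi X <= lo X'.
  case: (disjoint_gaps X X') => //.
  - by move=> e; apply: nc; rewrite -e; exact: conn_refl.
  - by apply/negP => l; apply: nc; exact: conn_link.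
  - by have := HG.1 _ GX'; lra.
have [g1 [g2 [cg1 cg2 lk h1 h2]]] := straddled _ _ _ c GX' nc d2 d1.
have [Gg1 Gg2] : G g1 /\ G g2 by case: (conn_G _ _ cg1); case: (conn_G _ _ cg2).
have nc1 : ~ conn g1 X' by move=> k; apply: nc; exact: conn_trans cg1 k.
have [_ t2] := trapped _ _ _ _ lk Gg1 Gg2 h1 h2 nc1 c'.
apply: (covered_pick X X Y g2) => //; first exact: conn_refl.
- by left.
- by left; lra.
- by left.
- by right; have := HG.1 _ Gg2; lra.
Qed.

(** Connectedness of the segment: the supremum of the points covered together with [x] is itself
    covered, and its cover reaches beyond it. *)
Lemma covered_segment x y : x <= y -> (forall z, x <= z <= y -> covered z z) -> covered x y.
Proof.
move=> xy cov.
pose S := [set z | x <= z <= y /\ covered x z].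
have Sx : S x by split; [rewrite lexx xy|apply: cov; rewrite lexx xy].
have ubS : ubound S y by move=> z [/andP[_ zy] _].
have hS : has_sup S by split; [exists x|exists y].
pose s := sup S.
have xs : x <= s by apply: ub_le_sup => //; exists y.
have sy : s <= y by apply: ge_sup => //; exists x.
have [X [Y [cXY [l1 _ l3 _]]]] : covered s s by apply: cov; rewrite xs sy.
have e0 : 0 < s - lo X by rewrite subr_gt0.
have [z [/andP[xz zy] cz] sz'] := sup_adherent e0 hS.
have lz : lo X < z by move: sz'; rewrite -/s; lra.
have zs : z <= s by apply: ub_le_sup; [exists y|split; rewrite ?xz].
have step w : lo X < w -> w < hi Y -> covered x w.
  move=> w1 w2; apply: (covered_trans z) => //.
  by exists X, Y; split => //; split => //; lra.
have [ys|sy'] := leP y s.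
  by apply: step; lra.
pose w := Num.min y ((s + hi Y) / 2).
have : S w.
  have w1 : s < w by rewrite /w lt_min sy' /=; lra.
  have w2 : w <= y by rewrite /w ge_min lexx.
  have w3 : w <= (s + hi Y) / 2 by rewrite /w ge_min lexx orbT.
  split; first by rewrite w2 andbT; lra.
  by apply: step; lra.
move=> Sw; have := ub_le_sup (ex_intro _ y ubS) Sw; rewrite -/s leNgt.
by rewrite /w lt_min sy' /=; lra.
Qed.
End connection.

(** * Chunks, gaps and thickness of compact sets *)

Section real_sets.
Context {R : realType}.

Lemma compact_has_max (A : set R) : compact A -> A !=set0 ->
  exists2 m, A m & forall x, A x -> x <= m.
Proof.
move=> cA nA.
have [|c Ac cmax] := compact_EVT_max nA cA (f := id).
  by apply: continuous_subspaceT => x; exact: cvg_id.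
by rewrite inE in Ac; exists c => // x Ax; apply: cmax; rewrite inE.
Qed.

Lemma compact_has_min (A : set R) : compact A -> A !=set0 ->
  exists2 m, A m & forall x, A x -> m <= x.
Proof.
move=> cA nA.
have [|c Ac cmax] := compact_EVT_min nA cA (f := id).
  by apply: continuous_subspaceT => x; exact: cvg_id.
by rewrite inE in Ac; exists c => // x Ax; apply: cmax; rewrite inE.
Qed.

Lemma compact_interval (A : set R) (u v : R) : compact A -> compact (A `&` `[u, v]).
Proof.
by move=> cA; apply: compact_closedI => //; exact: interval_closed.
Qed.

Definition is_gap (A : set R) (l r : R) :=
  [/\ A l, A r, l < r & forall x, l < x -> x < r -> ~ A x].

Lemma gap_around (A : set R) (y1 y2 x : R) : compact A -> A y1 -> A y2 ->
  y1 <= x -> x <= y2 -> ~ A x -> exists l r, [/\ is_gap A l r, l < x & x < r].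
Proof.
move=> cA A1 A2 y1x xy2 nAx.
have [|l [Al /= lx] lmax] := compact_has_max _ (compact_interval A y1 x cA).
  by exists y1; split => //=; rewrite in_itv /= lexx y1x.
have [|r [Ar /= rx] rmin] := compact_has_min _ (compact_interval A x y2 cA).
  by exists y2; split => //=; rewrite in_itv /= lexx xy2.
move: lx rx; rewrite !in_itv /= => /andP[y1l lx] /andP[xr ry2].
have {}lx : l < x by rewrite lt_neqAle lx andbT; apply/eqP => e; apply: nAx; rewrite -e.
have {}xr : x < r by rewrite lt_neqAle xr andbT; apply/eqP => e; apply: nAx; rewrite e.
exists l, r; split => //; split => //; first exact: lt_trans lx xr.
move=> z lz zr Az.
have [zx|xz] := leP z x.
  suff : z <= l by rewrite leNgt lz.
  by apply: lmax; split => //=; rewrite in_itv /= zx (le_trans y1l) // ltW.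
suff : r <= z by rewrite leNgt zr.
by apply: rmin; split => //=; rewrite in_itv /= (ltW xz) (le_trans (ltW zr)).
Qed.

Lemma set_dist_le (A B : set R) x y : A x -> B y -> set_dist A B <= `|x - y|.
Proof.
move=> Ax By; apply: ge_inf; last by exists x => //; exists y.
by exists 0 => _ [u _ [v _ <-]].
Qed.

Lemma set_dist_ge (A B : set R) e : A !=set0 -> B !=set0 ->
  (forall x y, A x -> B y -> e <= `|x - y|) -> e <= set_dist A B.
Proof.
move=> [x Ax] [y By] h; apply: lb_le_inf; first by exists `|x - y|, x => //; exists y.
by move=> _ [u Au [v Bv <-]]; apply: h.
Qed.

Lemma diam_le (A : set R) u v : u <= v -> A !=set0 -> (forall x, A x -> u <= x <= v) ->
  diam A <= v - u.
Proof.
move=> uv [x Ax] h; apply: ge_sup; first by exists `|x - x|, x => //; exists x.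
move=> _ [y Ay [z Az <-]].
have /andP[? ?] := h y Ay; have /andP[? ?] := h z Az.
by rewrite ler_norml; apply/andP; split; lra.
Qed.

Lemma diam_ge (A : set R) u v x y : (forall x, A x -> u <= x <= v) -> A x -> A y ->
  y - x <= diam A.
Proof.
move=> h Ax Ay; apply: (@le_trans _ _ `|y - x|); first exact: ler_norm.
apply: ub_le_sup; last by exists y => //; exists x.
exists (v - u) => _ [a Aa [b Ab <-]].
have /andP[? ?] := h a Aa; have /andP[? ?] := h b Ab.
by rewrite ler_norml; apply/andP; split; lra.
Qed.

Lemma thickness_chunk (A : set R) (tau : R) P : (tau%:E <= thickness A)%E -> chunk A P ->
  tau * set_dist P (A `\` P) <= diam P.
Proof.
move=> + cP; have [_ _ _ d0] := cP.
rewrite /thickness; case: asboolP => [_|]; last by case; exists P.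
move=> h; rewrite -ler_pdivlMr // -lee_fin; apply: le_trans h _.
by apply: ereal_inf_lbound; exists P.
Qed.

(* The part of [A] in [u, v] is a chunk as soon as both sides are free of
   points of [A] at distance less than [e]. *)
Lemma thickness_bridge (A : set R) (tau u v e z : R) : 0 < tau ->
  (tau%:E <= thickness A)%E -> 0 < e -> A u -> A v -> u <= v ->
  A z -> (z < u \/ v < z) ->
  (forall y, A y -> y < u -> y <= u - e) -> (forall y, A y -> v < y -> v + e <= y) ->
  tau * e <= v - u.
Proof.
move=> tau0 hA e0 Au Av uv Az zuv hl hr.
pose P := A `&` `[u, v].
have Pu : P u by split => //=; rewrite in_itv /= lexx uv.
have nPz : ~ P z by case=> _ /=; rewrite in_itv /= => /andP[? ?]; case: zuv; lra.
have d : e <= set_dist P (A `\` P).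
  apply: set_dist_ge; [by exists u|by exists z|].
  move=> x y [Ax /=]; rewrite in_itv /= => /andP[ux xv] [Ay nPy].
  have [yu|uy] := ltP y u.
    have := hl y Ay yu; rewrite ger0_norm; lra.
  have [vy|yv] := ltP v y.
    have := hr y Ay vy; rewrite ler0_norm; lra.
  by exfalso; apply: nPy; split => //=; rewrite in_itv /= uy yv.
have cP : chunk A P.
  split; [by exists u, v|by exists u| |exact: lt_le_trans d].
  by split=> [x []//|h]; apply: nPz; apply: h.
apply: (@le_trans _ _ (diam P)); last first.
  by apply: diam_le => //; [exists u|move=> x [_ /=]; rewrite in_itv].
apply: le_trans (thickness_chunk _ _ _ hA cP).
by rewrite ler_pM2l.
Qed.
End real_sets.

Section gaps_of_compact_sets.
Context {R : realType}.

Lemma largest_gap (A : set R) (u v x : R) : compact A -> A x -> u <= x -> x <= v ->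
  (exists l r, [/\ is_gap A l r, l <= v & u <= r]) ->
  exists l r, [/\ is_gap A l r, l <= v, u <= r &
    forall l' r', is_gap A l' r' -> l' <= v -> u <= r' -> r' - l' <= r - l].
Proof.
move=> cA Ax ux xv [l0 [r0 [g0 lv0 ur0]]].
pose T := [set p : R * R | [/\ A p.1, A p.2, p.1 <= v & u <= p.2] /\
  forall z, A z -> z <= p.1 \/ p.2 <= z].
have gapT l r : is_gap A l r -> l <= v -> u <= r -> T (l, r).
  move=> [Al Ar lr free] lv ur; split => //= z Az.
  have [|lz] := leP z l; first by left.
  by have [|zr] := leP r z; [right|case: (free z)].
have cT : compact T.
  have -> : T = (A `*` A) `&` ([set p | p.1 <= v] `&` [set p | u <= p.2] `&`
      \bigcap_(z in A) ([set p : R * R | z <= p.1] `|` [set p : R * R | p.2 <= z])).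
    apply/seteqP; split => -[l r] /=.
      by move=> [[? ? ? ?] h]; split => //; split => // z Az; exact: h.
    by move=> [[? ?] [[? ?] h]]; split => // z Az; exact: h.
  apply: compact_closedI; first exact: compact_setX.
  have c1 : continuous (@fst R R) by move=> p; exact: cvg_fst.
  have c2 : continuous (@snd R R) by move=> p; exact: cvg_snd.
  apply: closedI; first apply: closedI.
  - by apply: (preimage_closed (D := [set y | y <= v])) => [p _|]; [exact: c1|exact: closed_le].
  - by apply: (preimage_closed (D := [set y | u <= y])) => [p _|]; [exact: c2|exact: closed_ge].
  apply: closed_bigI => z _; apply: closedU.
  - by apply: (preimage_closed (D := [set y | z <= y])) => [p _|]; [exact: c1|exact: closed_ge].
  - by apply: (preimage_closed (D := [set y | y <= z])) => [p _|]; [exact: c2|exact: closed_le].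
have T0 : T !=set0 by exists (l0, r0); exact: gapT.
have [|[l r] + lmax] := compact_EVT_max T0 cT (f := fun p : R * R => p.2 - p.1).
  apply: continuous_subspaceT => p; apply: cvgB; [exact: cvg_snd|exact: cvg_fst].
rewrite inE => -[/= [Al Ar lv ur] free].
have mx l' r' : is_gap A l' r' -> l' <= v -> u <= r' -> r' - l' <= r - l.
  by move=> g lv' ur'; apply: (lmax (l', r')); rewrite inE; exact: gapT.
have lr : l < r.
  by have := mx _ _ g0 lv0 ur0; case: g0 => _ _ lr0 _; lra.
exists l, r; split => //; split => // z lz zr Az.
by case: (free z Az); lra.
Qed.

Lemma gap_bridge (A : set R) (tau l r l' r' : R) : 0 < tau -> (tau%:E <= thickness A)%E ->
  is_gap A l r -> is_gap A l' r' -> r <= l' -> r + tau * Num.min (r - l) (r' - l') <= l'.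
Proof.
move=> tau0 hA [Al Ar lr free] [Al' Ar' lr' free'] rl'.
have m1 : Num.min (r - l) (r' - l') <= r - l by rewrite ge_min lexx.
have m2 : Num.min (r - l) (r' - l') <= r' - l' by rewrite ge_min lexx orbT.
suff : tau * Num.min (r - l) (r' - l') <= l' - r by lra.
apply: (thickness_bridge _ _ _ _ _ l tau0 hA) => //.
- by rewrite lt_min !subr_gt0 lr.
- by left.
- move=> y Ay yr; have [|ly] := leP y l; first by lra.
  by case: (free y ly yr).
- move=> y Ay ly; have [|yr] := leP r' y; first by lra.
  by case: (free' y ly yr).
Qed.

Lemma gap_bridge_left (A : set R) (tau u l r : R) : 0 < tau -> (tau%:E <= thickness A)%E ->
  A u -> (forall y, A y -> y < u -> y <= u - (r - l)) ->
  is_gap A l r -> u <= l -> u + tau * (r - l) <= l.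
Proof.
move=> tau0 hA Au hu [Al Ar lr free] ul.
suff : tau * (r - l) <= l - u by lra.
apply: (thickness_bridge _ _ _ _ _ r tau0 hA) => //.
- by rewrite subr_gt0.
- by right.
- move=> y Ay ly; have [|yr] := leP r y; first by lra.
  by case: (free y ly yr).
Qed.

Lemma gap_bridge_right (A : set R) (tau u l r : R) : 0 < tau -> (tau%:E <= thickness A)%E ->
  A u -> (forall y, A y -> u < y -> u + (r - l) <= y) ->
  is_gap A l r -> r <= u -> r + tau * (r - l) <= u.
Proof.
move=> tau0 hA Au hu [Al Ar lr free] ru.
suff : tau * (r - l) <= u - r by lra.
apply: (thickness_bridge _ _ _ _ _ l tau0 hA) => //.
- by rewrite subr_gt0.
- by left.
- move=> y Ay yr; have [|ly] := leP y l; first by lra.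
  by case: (free y ly yr).
Qed.

Lemma interior_convex_hull (A : set R) (u v x : R) : (forall y, A y -> u <= y <= v) ->
  interior (convex_hull A) x -> u < x /\ x < v.
Proof.
move=> h.
have sub : convex_hull A `<=` `[u, v].
  apply: smallest_sub; last by move=> y /h; rewrite /= in_itv.
  move=> y z k; rewrite !inE /= !in_itv /= => /andP[y1 y2] /andP[z1 z2].
  have [yz|zy] := leP y z.
    have := convR_itv k yz; rewrite in_itv /= => /andP[h1 h2].
    by rewrite (le_trans y1 h1) (le_trans h2 z2).
  rewrite convC; move: (widen_itv _) => k'.
  have := convR_itv k' (ltW zy); rewrite in_itv /= => /andP[h1 h2].
  by rewrite (le_trans z1 h1) (le_trans h2 y2).
by move/(interiorS sub); rewrite interior_itv_bnd /= in_itv /= => /andP[].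
Qed.
End gaps_of_compact_sets.

(** * The core of a window *)

Section window.
Context {R : realType} {t : R} {tau : bool -> R}.
Hypothesis t0 : 0 < t.
Hypothesis kap0 : forall c, 0 < kap (t:=t) (tau:=tau) c.
Hypothesis disc0 : forall c, 0 < disc (t:=t) (tau:=tau) c.
Hypothesis psi0 : 0 < psi t (tau true) (tau false).
Hypothesis phi0 : 0 < phi t (tau true) (tau false).
Notation link := (link (t:=t)).
Notation gap := (gap (R:=R)).
Notation phi0' := (phi t (tau true) (tau false)).

(** [a] and [b] are the inner ends of the outer gaps, and the first two bridge hypotheses treat
    these as larger than every gap meeting the window. [Cright] and [Cleft] make each missing point
    of the window lie in a bounded gap. *)
Context {C : bool -> set R} {c : bool} {a b : R}.
Hypotheses (cC : forall i, compact (C i)) (ab : a < b) (Ca : C c a) (Cb : C (~~ c) b)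
  (Cright : exists2 y, C c y & b <= y) (Cleft : exists2 y, C (~~ c) y & y <= a)
  (bridge_left : forall l r, is_gap (C c) l r -> l < b -> a < r -> a + tau c * (r - l) <= l)
  (bridge_right : forall l r, is_gap (C (~~ c)) l r -> l < b -> a < r ->
     r + tau (~~ c) * (r - l) <= b)
  (bridge : forall i l r l' r', is_gap (C i) l r -> is_gap (C i) l' r' -> r <= l' ->
     r + tau i * Num.min (r - l) (r' - l') <= l').

(* The two outer gaps are cut down to a length which dominates all the gaps
   meeting the window while keeping the outer gaps unlinked. *)
Let H := (b - a) / Num.min (tau true) (tau false).
Let eL : gap := (c, a - H, a).
Let eR : gap := (~~ c, b, b + H).
Definition window_gaps : set gap := [set g |
  [\/ g = eL, g = eR | [/\ is_gap (C (ty g)) (lo g) (hi g), lo g < b & a < hi g]]].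
Let G := window_gaps.

Let tau_pos i : 0 < tau i.
Proof. exact: lt_trans t0 (tau_gt kap0 i). Qed.

Let mint : t < Num.min (tau true) (tau false).
Proof. by rewrite lt_min !tau_gt. Qed.

Let H0 : 0 < H.
Proof. by rewrite divr_gt0 ?subr_gt0 // (lt_trans t0). Qed.

Let tH : t * H < b - a.
Proof.
rewrite /H mulrA ltr_pdivrMr ?(lt_trans t0) // mulrC ltr_pM2l //.
by rewrite subr_gt0.
Qed.

Let lt_H i s : tau i * s < b - a -> s < H.
Proof.
move=> h; have [//|Hs] := ltP s H; exfalso.
have m0 : 0 < Num.min (tau true) (tau false) by rewrite (lt_trans t0).
have : Num.min (tau true) (tau false) * H = b - a by rewrite /H mulrC divfK // gt_eqF.
have h1 : Num.min (tau true) (tau false) <= tau i.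
  by rewrite ge_min; case: (i); rewrite lexx ?orbT.
have : Num.min (tau true) (tau false) * H <= tau i * s.
  by apply: ler_pM => //; exact: ltW.
by move=> h2 h3; move: h; rewrite -h3 ltNge h2.
Qed.

Let GL : G eL. Proof. exact: Or31. Qed.
Let GR : G eR. Proof. exact: Or32. Qed.

Let gap_sz g : is_gap (C (ty g)) (lo g) (hi g) -> lo g < b -> a < hi g -> sz g < H.
Proof.
move=> gg lb ra; have [tg|tg] := eqVneq (ty g) c.
  rewrite tg in gg; apply: (lt_H c); have := bridge_left _ _ gg lb ra.
  rewrite /sz; lra.
have {}tg : ty g = ~~ c by case: (ty g) tg; case: (c).
rewrite tg in gg; apply: (lt_H (~~ c)); have := bridge_right _ _ gg lb ra.
rewrite /sz; lra.
Qed.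

Let szL : sz eL = H. Proof. by rewrite /sz /eL /hi /lo /=; lra. Qed.
Let szR : sz eR = H. Proof. by rewrite /sz /eR /hi /lo /=; lra. Qed.

Let sz_le g : G g -> sz g <= H.
Proof.
case=> [->|->|[gg lb ra]]; [by rewrite szL|by rewrite szR|].
by apply: ltW; apply: gap_sz.
Qed.

Let gap_eq (g h : gap) : ty g = ty h -> lo g = lo h -> hi g = hi h -> g = h.
Proof. by case: g h => [[? ?] ?] [[? ?] ?]; rewrite /ty /lo /hi /= => -> -> ->. Qed.

Let c_neq : c <> ~~ c. Proof. by case: (c). Qed.

Lemma window_spaced : spaced (tau:=tau) G.
Proof.
have real_lt g : is_gap (C (ty g)) (lo g) (hi g) -> lo g < hi g by case.
split.
  move=> x [->|->|[/real_lt //]]; rewrite /eL /eR /lo /hi /=; have := H0; lra.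
have LL g : is_gap (C (ty g)) (lo g) (hi g) -> lo g < b -> a < hi g -> ty g = c ->
    hi eL + tau c * Num.min (sz eL) (sz g) <= lo g.
  move=> gg lb ra tg; rewrite szL (min_idPr (ltW (gap_sz _ gg lb ra))).
  by rewrite tg in gg; apply: bridge_left.
have RR g : is_gap (C (ty g)) (lo g) (hi g) -> lo g < b -> a < hi g -> ty g = ~~ c ->
    hi g + tau (~~ c) * Num.min (sz g) (sz eR) <= lo eR.
  move=> gg lb ra tg; rewrite szR (min_idPl (ltW (gap_sz _ gg lb ra))).
  by rewrite tg in gg; apply: bridge_right.
move=> x y [xE|xE|[gx lx rx]] [yE|yE|[gy ly ry]] txy xy.
- by case: xy; rewrite xE yE.
- by case: c_neq; move: txy; rewrite xE yE.
- by left; rewrite xE; apply: LL => //; rewrite -txy xE.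
- by case: c_neq; apply: esym; move: txy; rewrite xE yE.
- by case: xy; rewrite xE yE.
- by right; rewrite xE minC; apply: RR => //; rewrite -txy xE.
- by right; rewrite txy yE minC; apply: LL => //; rewrite txy yE.
- by left; rewrite txy yE; apply: RR => //; rewrite txy yE.
have [d|d] := leP (hi x) (lo y).
  left; rewrite txy in gx *.
  exact: bridge gx gy d.
right; rewrite minC.
suff d2 : hi y <= lo x by rewrite txy in gx *; exact: bridge gy gx d2.
rewrite leNgt; apply/negP => d2; apply: xy; apply: gap_eq => //.
  rewrite txy in gx; case: gx gy => [x1 x2 x3 x4] [y1 y2 y3 y4].
  apply/eqP; rewrite eq_le !leNgt; apply/andP; split; apply/negP => e.
    by apply: (y4 (lo x)).
  by apply: (x4 (lo y)).
rewrite txy in gx; case: gx gy => [x1 x2 x3 x4] [y1 y2 y3 y4].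
apply/eqP; rewrite eq_le !leNgt; apply/andP; split; apply/negP => e.
  by apply: (x4 (hi y)).
by apply: (y4 (hi x)).
Qed.
Let HG := window_spaced.
Let conn := conn (t:=t) (G:=G).
Let covered := covered (t:=t) (G:=G).
Let lo_hi g : G g -> lo g < hi g. Proof. exact: HG.1. Qed.

Let outer_left g : G g -> lo g < a -> conn eL g.
Proof.
move=> Gg ga; case: (Gg) => [->|gE|[gg lb ra]].
- exact: conn_refl.
- by move: ga; rewrite gE /eR /lo /=; have := ab; lra.
have [tg|tg] := eqVneq (ty g) c.
  rewrite tg in gg; have := bridge_left _ _ gg lb ra.
  have sg : 0 < hi g - lo g by rewrite subr_gt0 lo_hi.
  have := mulr_gt0 (tau_pos c) sg; lra.
apply: conn_link => //; rewrite /link eq_sym tg /=.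
have m0 : 0 < t * Num.min (sz eL) (sz g) by rewrite mulr_gt0 // (minsz_gt0 HG).
apply/andP; split; move: m0; rewrite /eL /hi /lo /= => ?; have := H0; rewrite /hi /lo in ra ga; lra.
Qed.

Let outer_right g : G g -> b < hi g -> conn eR g.
Proof.
move=> Gg gb; case: (Gg) => [gE|->|[gg lb ra]].
- by move: gb; rewrite gE /eL /hi /=; have := ab; lra.
- exact: conn_refl.
have [tg|tg] := eqVneq (ty g) (~~ c).
  rewrite tg in gg; have := bridge_right _ _ gg lb ra.
  have sg : 0 < hi g - lo g by rewrite subr_gt0 lo_hi.
  have := mulr_gt0 (tau_pos (~~ c)) sg; lra.
apply: conn_link => //; rewrite /link eq_sym tg /=.
have m0 : 0 < t * Num.min (sz eR) (sz g) by rewrite mulr_gt0 // (minsz_gt0 HG).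
apply/andP; split; move: m0; rewrite /eR /hi /lo /= => ?; have := H0; rewrite /hi /lo in lb gb; lra.
Qed.

Let outer_unlinked : ~~ link eL eR.
Proof.
apply/negP => /and3P[_ + _]; rewrite szL szR minxx.
by rewrite leNgt tH.
Qed.

Let hi_ge g : G g -> a <= hi g.
Proof. by case=> [->|->|[_ _ /ltW//]]; rewrite /eL /eR /hi /=; have := ab; have := H0; lra. Qed.

Let lo_le g : G g -> lo g <= b.
Proof. by case=> [->|->|[_ /ltW// _]]; rewrite /eL /eR /lo /=; have := ab; have := H0; lra. Qed.

(** No gap exceeds [eL], so on a path from [eL] to [eR] the second gap would dominate [eR], which
    has its type. Genuine gaps are shorter than [H], so the second gap would be [eR] itself, which
    is not linked to [eL]. *)
Lemma outer_not_conn : ~ conn eL eR.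
Proof.
move=> /conn_uniq[[|h s] [ps us ls Gs]].
  by move: ls => /= [e _ _]; exact: c_neq.
have GG g : g \in eL :: h :: s -> G g by move=> gin; exact: (conn_G _ _ (Gs _ gin)).2.
have same g : g \in h :: s -> ty g = ty eL -> sz g <= sz eL.
  by move=> gs _; rewrite szL; apply: sz_le; apply: GG; rewrite inE gs orbT.
have lk : link eL h by move: ps => /= /andP[].
have hin : h \in h :: s := mem_head _ _.
have [_ _] := neighbour_bound t0 kap0 disc0 HG eL h s ps us GG same _ (mem_last h s).
have -> : last h s = eR by exact: ls.
rewrite (link_ty _ _ lk) => /(_ erefl); rewrite szR => Hh.
have : G h by apply: GG; rewrite inE hin orbT.
case=> [hE|hE|[gg lb ra]].
- by move: us; rewrite hE /= inE eqxx.
- by move: outer_unlinked; rewrite -hE lk.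
- by have := gap_sz _ gg lb ra; rewrite ltNge Hh.
Qed.

Definition window_core : set R := [set x | a <= x <= b /\ ~ covered x x].
Let K := window_core.

Lemma window_core_sub i : K `<=` C i.
Proof.
move=> x [/andP[ax xb] nx]; have [//|nC] := pselect (C i x); exfalso; apply: nx.
have [y1 [y2 [C1 C2 y1x xy2]]] : exists y1 y2, [/\ C i y1, C i y2, y1 <= x & x <= y2].
  have [->|ic] := eqVneq i c.
    by case: Cright => y Cy yb; exists a, y; split => //; exact: le_trans yb.
  have -> : i = ~~ c by case: (i) ic; case: (c).
  by case: Cleft => y Cy yb; exists y, b; split => //; exact: le_trans ax.
have [l [r [gap_lr lx xr]]] := gap_around _ _ _ _ (cC i) C1 C2 y1x xy2 nC.
have Gg : G (i, l, r).
  by apply: Or33; split => //; [exact: lt_le_trans xb|exact: le_lt_trans xr].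
by exists (i, l, r), (i, l, r); split; [exact: conn_refl|].
Qed.

Lemma window_core_compact : compact K.
Proof.
pose U := \bigcup_(p in [set p : gap * gap | conn p.1 p.2]) [set` `]lo p.1, hi p.2[ ].
have -> : K = `[a, b] `&` ~` U.
  apply/seteqP; split => x /=; rewrite in_itv /=.
    move=> [-> nx]; split => // -[[X Y] /= cXY]; rewrite in_itv /= => /andP[? ?].
    by apply: nx; exists X, Y.
  move=> [xab nU]; split => //; move=> [X [Y [cXY [? _ ? _]]]]; apply: nU.
  by exists (X, Y) => //=; rewrite in_itv; apply/andP.
apply: compact_closedI; first exact: segment_compact.
apply: open_closedC; apply: bigcup_open => p _; exact: interval_open.
Qed.

Let conn_left_le g : conn eL g -> hi g <= b.
Proof.
move=> cg; rewrite leNgt; apply/negP => bg; apply: outer_not_conn.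
have [_ Gg] := conn_G _ _ cg.
by apply: (conn_trans _ _ _ cg); apply: conn_sym; exact: outer_right.
Qed.

Let conn_right_ge g : conn eR g -> a <= lo g.
Proof.
move=> cg; rewrite leNgt; apply/negP => ga; apply: outer_not_conn.
have [_ Gg] := conn_G _ _ cg.
by apply: (conn_trans _ _ _ (outer_left _ Gg ga)); exact: conn_sym.
Qed.

Let cLL : conn eL eL. Proof. exact: conn_refl. Qed.
Let cRR : conn eR eR. Proof. exact: conn_refl. Qed.

(** The first point of [K] is the supremum of the right ends in the component of [eL], attained or
    not. *)
Lemma core_left : exists al, [/\ K al, forall x, K x -> al <= x,
  forall g, conn eL g -> hi g <= al & forall e, 0 < e -> exists2 g, conn eL g & al - e < hi g].
Proof.
pose S := [set hi g | g in conn eL].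
have Sa : S a by exists eL.
have ubS : ubound S b by move=> _ [g cg <-]; exact: conn_left_le.
have hS : has_sup S by split; [exists a|exists b].
have leS g : conn eL g -> hi g <= sup S.
  by move=> cg; apply: ub_le_sup; [exists b|exists g].
have adh e : 0 < e -> exists2 g, conn eL g & sup S - e < hi g.
  by move=> e0; have [_ [g cg <-] h] := sup_adherent e0 hS; exists g.
have aS : a <= sup S by apply: ub_le_sup => //; exists b.
exists (sup S); split => //.
  split; first by rewrite aS; apply: ge_sup => //; exists a.
  move=> [X [Y [cXY [l1 _ l2 _]]]].
  (* The point [a - H / 2] inside [eL] is a marker: only gaps connected to [eL] start to its left,
     so a cover joining it to [sup S] would carry that component beyond [sup S]. *)
  pose m := Num.max (lo X) (a - H / 2).
  have mX : lo X <= m by rewrite /m le_max lexx.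
  have mL : a - H / 2 <= m by rewrite /m le_max lexx orbT.
  have HH := H0.
  have mS : m < sup S by rewrite /m gt_max l1 /=; lra.
  have [g cg gm] := adh (sup S - m) ltac:(by rewrite subr_gt0).
  have gS := leS g cg.
  have {}gm : m < hi g by lra.
  have cov1 : covered (a - H / 2) ((m + hi g) / 2).
    by exists eL, g; split => //; rewrite /eL /lo /=; split; lra.
  have cov2 : covered ((m + hi g) / 2) (sup S).
    by exists X, Y; split => //; split; lra.
  have [X' [Y' [cXY' [l1' _ _ l2']]]] := covered_trans t0 kap0 HG _ _ _ cov1 cov2.
  have GX' := (conn_G _ _ cXY').1.
  have cX' : conn eL X' by apply: outer_left => //; lra.
  have := leS Y' (conn_trans _ _ _ cX' cXY'); lra.
move=> x [/andP[ax xb] nx]; rewrite leNgt; apply/negP => xS; apply: nx.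
have [g cg gm] := adh (sup S - x) ltac:(by rewrite subr_gt0).
have HH := H0.
by exists eL, g; split => //; rewrite /eL /lo /=; split; lra.
Qed.

Lemma core_right : exists be, [/\ K be, forall x, K x -> x <= be,
  forall g, conn eR g -> be <= lo g & forall e, 0 < e -> exists2 g, conn eR g & lo g < be + e].
Proof.
pose S := [set lo g | g in conn eR].
have Sb : S b by exists eR.
have lbS : lbound S a by move=> _ [g cg <-]; exact: conn_right_ge.
have hS : has_inf S by split; [exists b|exists a].
have geS g : conn eR g -> inf S <= lo g.
  by move=> cg; apply: ge_inf; [exists a|exists g].
have adh e : 0 < e -> exists2 g, conn eR g & lo g < inf S + e.
  by move=> e0; have [_ [g cg <-] h] := inf_adherent e0 hS; exists g.
have bS : inf S <= b by apply: ge_inf => //; exists a.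
exists (inf S); split => //.
  split; first by rewrite bS andbT; apply: lb_le_inf => //; exists b.
  move=> [X [Y [cXY [l1 _ l2 _]]]].
  pose m := Num.min (hi Y) (b + H / 2).
  have mX : m <= hi Y by rewrite /m ge_min lexx.
  have mL : m <= b + H / 2 by rewrite /m ge_min lexx orbT.
  have HH := H0.
  have mS : inf S < m by rewrite /m lt_min l2 /=; lra.
  have [g cg gm] := adh (m - inf S) ltac:(by rewrite subr_gt0).
  have gS := geS g cg.
  have {}gm : lo g < m by lra.
  have cov1 : covered ((m + lo g) / 2) (b + H / 2).
    exists g, eR; split; first exact: conn_sym.
    by rewrite /eR /hi /=; split; lra.
  have cov2 : covered (inf S) ((m + lo g) / 2).
    by exists X, Y; split => //; split; lra.
  have [X' [Y' [cXY' [l1' _ _ l2']]]] := covered_trans t0 kap0 HG _ _ _ cov2 cov1.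
  have GY' := (conn_G _ _ cXY').2.
  have cY' : conn eR Y' by apply: outer_right => //; lra.
  have := geS X' (conn_trans _ _ _ cY' (conn_sym _ _ cXY')); lra.
move=> x [/andP[ax xb] nx]; rewrite leNgt; apply/negP => xS; apply: nx.
have [g cg gm] := adh (x - inf S) ltac:(by rewrite subr_gt0).
have HH := H0.
exists g, eR; split; first exact: conn_sym.
by rewrite /eR /hi /=; split; lra.
Qed.

(** The distance controls the span of the component whose largest gap is the smaller one. An outer
    gap has the maximal size [H], so its presence decides which component that is. *)
Lemma components_apart X X0 Y Y2 : conn X X0 -> conn Y Y2 ->
  (forall Z W, conn X Z -> conn Y W -> hi Z <= lo W /\ ~~ link Z W) ->
  [/\ X0 = eL -> phi0' * (hi Y2 - lo Y) <= lo Y - hi X,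
      Y2 = eR -> phi0' * (hi X - lo X0) <= lo Y - hi X &
      phi0' * (hi Y2 - lo Y) <= lo Y - hi X \/ phi0' * (hi X - lo X0) <= lo Y - hi X].
Proof.
move=> /conn_uniq[s [ps us ls cs]] /conn_uniq[s' [ps' us' ls' cs']] sep.
have Gs g : g \in X :: s -> G g by move=> /cs cg; exact: (conn_G _ _ cg).2.
have Gs' g : g \in Y :: s' -> G g by move=> /cs' cg; exact: (conn_G _ _ cg).2.
have s1 u v : u \in X :: s -> v \in Y :: s' -> hi u <= lo v.
  by move=> /cs cu /cs' cv; case: (sep _ _ cu cv).
have s2 u v : u \in X :: s -> v \in Y :: s' -> ~~ link u v.
  by move=> /cs cu /cs' cv; case: (sep _ _ cu cv).
have right := span_right_le_dist t0 kap0 disc0 psi0 _ _ _ _ _ HG ps us ps' us' Gs Gs' s1 s2.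
have left := span_left_le_dist t0 kap0 disc0 psi0 _ _ _ _ _ HG ps us ps' us' Gs Gs' s1 s2.
rewrite ls ls' in right left; split.
- move=> X0E; apply: right; exists X0; first by rewrite -ls mem_last.
  by move=> v /Gs' Gv; rewrite X0E szL sz_le.
- move=> YE; apply: left; exists Y2; first by rewrite -ls' mem_last.
  by move=> v /Gs Gv; rewrite YE szR sz_le.
have [h hin hmax] := exists_max (sz (R:=R)) X s.
have [h' hin' hmax'] := exists_max (sz (R:=R)) Y s'.
have [hh|hh] := leP (sz h) (sz h'); [right|left].
  by apply: left; exists h' => // v /hmax vh; exact: le_trans hh.
by apply: right; exists h => // v /hmax' vh; exact: le_trans (ltW hh).
Qed.

(** The right path ends in [eR], which reaches [H] beyond the window, so its span is at least
    [H]. *)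
Lemma outer_apart X Y : conn eL X -> conn eR Y -> phi0' * H <= lo Y - hi X.
Proof.
move=> cX cY; have HH := H0.
have sep Z W : conn X Z -> conn Y W -> hi Z <= lo W /\ ~~ link Z W.
  move=> cXZ cYW; have cZ := conn_trans _ _ _ cX cXZ; have cW := conn_trans _ _ _ cY cYW.
  have [_ GZ] := conn_G _ _ cZ; have [_ GW] := conn_G _ _ cW.
  split; last first.
    apply/negP => l; apply: outer_not_conn; apply: (conn_trans _ _ _ cZ).
    by apply: (conn_trans _ _ _ (conn_link _ _ GZ GW l)); exact: conn_sym.
  rewrite leNgt; apply/negP => WZ; apply: outer_not_conn.
  have hZ := hi_ge _ GZ; have lW := lo_le _ GW; have Zb := conn_left_le _ cZ.
  pose m := Num.max (lo W) (a - H / 2).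
  have mW : lo W <= m by rewrite /m le_max lexx.
  have mL : a - H / 2 <= m by rewrite /m le_max lexx orbT.
  have mZ : m < hi Z by rewrite /m gt_max WZ /=; lra.
  have ab' := ab.
  have cov1 : covered (a - H / 2) ((m + hi Z) / 2).
    by exists eL, Z; split => //; rewrite /eL /lo /=; split; lra.
  have cov2 : covered ((m + hi Z) / 2) (b + H / 2).
    exists W, eR; split; first exact: conn_sym.
    by rewrite /eR /hi /=; split; lra.
  have [X' [Y' [cXY' [l1' _ _ l2']]]] := covered_trans t0 kap0 HG _ _ _ cov1 cov2.
  have [GX' GY'] := conn_G _ _ cXY'.
  have cX' : conn eL X' by apply: outer_left => //; lra.
  have cY' : conn eR Y' by apply: outer_right => //; lra.
  by apply: (conn_trans _ _ _ cX'); apply: (conn_trans _ _ _ cXY'); exact: conn_sym.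
have [+ _ _] := components_apart _ _ _ _ (conn_sym _ _ cX) (conn_sym _ _ cY) sep.
move/(_ erefl); apply: le_trans; rewrite ler_pM2l //.
have := lo_le _ (conn_G _ _ cY).2; rewrite /eR /hi /=; lra.
Qed.

Lemma core_wide : exists x y, [/\ K x, K y & x < y].
Proof.
have [al [Ka _ _ adhl]] := core_left; have [be [Kb _ _ adhr]] := core_right.
exists al, be; split => //.
have pH : 0 < phi0' * H by rewrite mulr_gt0.
have [X cX hX] := adhl (phi0' * H / 2) ltac:(by rewrite divr_gt0).
have [Y cY lY] := adhr (phi0' * H / 2) ltac:(by rewrite divr_gt0).
have := outer_apart _ _ cX cY; lra.
Qed.

Let covered_gap x y : a <= x -> y <= b -> x <= y -> (forall z, x <= z <= y -> ~ K z) ->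
  exists X Y, [/\ conn X Y, lo X < x & y < hi Y].
Proof.
move=> ax yb xy nK.
have [X [Y [cXY [l1 _ _ l2]]]] : covered x y.
  apply: covered_segment => // z zxy.
  have [//|nz] := pselect (covered z z); case: (nK z zxy); split => //.
  by case/andP: zxy => xz zy; rewrite (le_trans ax xz) (le_trans zy yb).
by exists X, Y.
Qed.

(** The free space to the left of [al] is filled by one component up to [e] at both ends. If it
    leaves the window, [al] is the first point of [K] and the component is that of [eL]. *)
Let left_component al d e : K al -> (forall z, K z -> z < al -> z <= al - d) -> 0 < e ->
  e < d / 2 ->
  exists X X0, [/\ conn X X0, al - e < hi X, lo X0 < al &
    X0 = eL /\ (forall z, K z -> al <= z) \/ lo X0 < al - d + e].
Proof.
move=> Ka free e0 ed; have [/andP[aal alb] nal] := Ka.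
have HH := H0.
have [da|da] := leP a (al - d).
  have [|||z /andP[z1 z2] Kz|X [Y [cXY l1 l2]]] := covered_gap (al - d + e) (al - e); try lra.
    by have := free z Kz ltac:(lra); lra.
  by exists Y, X; split; [exact: conn_sym|done|lra|right].
have [al0 [Ka0 minK _ adh]] := core_left.
have alE : al0 = al.
  apply/eqP; rewrite eq_le minK //= leNgt; apply/negP => lt.
  have [/andP[aal0 _] _] := Ka0.
  by have := free al0 Ka0 lt; lra.
have [g cg gm] := adh e e0.
exists g, eL; split; [exact: conn_sym|by rewrite -alE|rewrite /eL /lo /=; lra|left].
by rewrite -alE.
Qed.

Let right_component be d e : K be -> (forall z, K z -> be < z -> be + d <= z) -> 0 < e
  -> e < d / 2 ->
  exists Y Y2, [/\ conn Y Y2, lo Y < be + e, be < hi Y2 &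
    Y2 = eR /\ (forall z, K z -> z <= be) \/ be + d - e < hi Y2].
Proof.
move=> Kb free e0 ed; have [/andP[abe beb] nbe] := Kb.
have HH := H0.
have [da|da] := leP (be + d) b.
  have [|||z /andP[z1 z2] Kz|X [Y [cXY l1 l2]]] := covered_gap (be + e) (be + d - e); try lra.
    by have := free z Kz ltac:(lra); lra.
  by exists X, Y; split => //; [lra|right].
have [be0 [Kb0 maxK _ adh]] := core_right.
have beE : be0 = be.
  apply/eqP; rewrite eq_le maxK // andbT leNgt; apply/negP => lt.
  have [/andP[_ beb0] _] := Kb0.
  by have := free be0 Kb0 lt; lra.
have [g cg gm] := adh e e0.
exists g, eR; split; [exact: conn_sym|by rewrite -beE|rewrite /eR /hi /=; lra|left].
by rewrite -beE.
Qed.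

Lemma core_chunk al be d y : K al -> K be -> al <= be -> 0 < d ->
  (forall z, K z -> z < al -> z <= al - d) -> (forall z, K z -> be < z -> be + d <= z) ->
  K y -> (y < al \/ be < y) -> phi0' * d <= be - al.
Proof.
move=> Ka Kb albe d0 freel freer Ky yout.
rewrite leNgt; apply/negP => bad.
pose r := phi0' * d - (be - al).
have r0 : 0 < r by rewrite subr_gt0.
have p0 := phi0.
(* The approximation shortens a span by at most [2 * e] and lengthens the distance by at most
   [2 * e]; the total loss [2 * e * (phi0' + 1)] stays below the defect [r]. *)
pose e := Num.min (d / 4) (r / (4 * (phi0' + 1))).
have dp : 0 < 4 * (phi0' + 1) by lra.
have e0 : 0 < e by rewrite /e lt_min !divr_gt0.
have ed4 : e <= d / 4 by rewrite /e ge_min lexx.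
have ed : e < d / 2 by lra.
have er : e * (4 * (phi0' + 1)) <= r.
  by rewrite -ler_pdivlMr // /e ge_min lexx orbT.
have [X [X0 [cX hX lX0 edgeX]]] := left_component _ _ _ Ka freel e0 ed.
have [Y [Y2 [cY lY hY2 edgeY]]] := right_component _ _ _ Kb freer e0 ed.
have [_ nal] := Ka; have [_ nbe] := Kb.
have hiZ Z : conn X Z -> hi Z <= al.
  move=> cZ; rewrite leNgt; apply/negP => lt; apply: nal.
  by exists X0, Z; split => //; exact: conn_trans (conn_sym _ _ cX) cZ.
have loW W : conn Y W -> be <= lo W.
  move=> cW; rewrite leNgt; apply/negP => lt; apply: nbe.
  by exists W, Y2; split => //; exact: conn_trans (conn_sym _ _ cW) cY.
(* [al] and [be] are not covered, so they separate the two components; a link would put [al] into a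
   common hull. *)
have sep Z W : conn X Z -> conn Y W -> hi Z <= lo W /\ ~~ link Z W.
  move=> cZ cW; split.
    by apply: le_trans (hiZ _ cZ) _; apply: le_trans albe (loW _ cW).
  apply/negP => l; apply: nal; exists X0, Y2; split; last by split => //; lra.
  have [_ GZ] := conn_G _ _ cZ; have [_ GW] := conn_G _ _ cW.
  apply: (conn_trans _ _ _ (conn_sym _ _ cX)); apply: (conn_trans _ _ _ cZ).
  apply: (conn_trans _ _ _ (conn_link _ _ GZ GW l)).
  exact: conn_trans (conn_sym _ _ cW) cY.
have [mL mR mB] := components_apart _ _ _ _ cX cY sep.
have fin u : d - 2 * e <= u -> ~ phi0' * u <= lo Y - hi X.
  move=> du h.
  have : phi0' * (d - 2 * e) <= phi0' * u by rewrite ler_pM2l.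
  rewrite /r in er r0; have := mulr_gt0 p0 e0; lra.
have hXX := hiZ _ (conn_refl _ (conn_G _ _ cX).1).
have lYY := loW _ (conn_refl _ (conn_G _ _ cY).1).
case: edgeX => [[X0E minK]|lX].
  case: edgeY => [[Y2E maxK]|hY].
    by have := minK _ Ky; have := maxK _ Ky; case: yout; lra.
  by apply: fin (mL X0E); lra.
case: edgeY => [[Y2E maxK]|hY].
  by apply: fin (mR Y2E); lra.
by case: mB; apply: fin; lra.
Qed.

Lemma core_thickness : (phi0'%:E <= thickness K)%E.
Proof.
have cK := window_core_compact.
rewrite /thickness; case: asboolP => [_|noch].
  apply: le_ereal_inf_tmp => _ [P [[u [v PE]] P0 [PK nKP] d0] <-].
  rewrite lee_fin ler_pdivlMr //.
  have cP : compact P by rewrite PE; exact: compact_interval.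
  have [al Pal lal] := compact_has_min _ cP P0.
  have [be Pbe lbe] := compact_has_max _ cP P0.
  have Kal := PK _ Pal; have Kbe := PK _ Pbe.
  have albe : al <= be by apply: lal.
  apply: (@le_trans _ _ (be - al)); last first.
    by apply: (@diam_ge _ _ al be) => // x Px; rewrite lal // lbe.
  have [y [Ky nPy]] : exists y, K y /\ ~ P y.
    by apply: contrapT => nex; apply: nKP => y Ky; apply: contrapT => nPy; apply: nex; exists y.
  have mid z : K z -> al <= z -> z <= be -> P z.
    move=> Kz; move: Pal Pbe; rewrite PE => -[_ /=]; rewrite in_itv /= => /andP[ual _] [_ /=].
    rewrite in_itv /= => /andP[_ bev] alz zbe.
    by split => //=; rewrite in_itv /= (le_trans ual alz) (le_trans zbe bev).
  apply: (core_chunk al be _ y) => //.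
  - move=> z Kz zal; have nPz : ~ P z by move=> /lal; rewrite leNgt zal.
    have : set_dist P (K `\` P) <= `|al - z| by apply: set_dist_le.
    rewrite ger0_norm; lra.
  - move=> z Kz bez; have nPz : ~ P z by move=> /lbe; rewrite leNgt bez.
    have : set_dist P (K `\` P) <= `|be - z| by apply: set_dist_le.
    rewrite ler0_norm; lra.
  - have [yal|aly] := ltP y al; first by left.
    have [bey|ybe] := ltP be y; first by right.
    by case: nPy; apply: mid.
(* [K] has two points. A point missing between its extremes would lie in a gap, and the part of [K]
   to the left of that gap would be a chunk. *)
case: asboolP => [_|nitv]; first exact: leey.
exfalso; apply: nitv.
have [x [y [Kx Ky xy]]] := core_wide.
have [al Kal lal] := compact_has_min _ cK (ex_intro _ x Kx).
have [be Kbe lbe] := compact_has_max _ cK (ex_intro _ x Kx).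
exists al, be; split; first by apply: le_lt_trans (lal _ Kx) _; exact: lt_le_trans (lbe _ Ky).
apply/seteqP; split => [z Kz|z /=]; first by rewrite /= in_itv /= lal // lbe.
rewrite in_itv /= => /andP[alz zbe]; apply: contrapT => nKz; apply: noch.
have [l [r [[Kl Kr lr free] lz zr]]] := gap_around _ _ _ _ cK Kal Kbe alz zbe nKz.
exists (K `&` `[al, l]); split.
- by exists al, l.
- by exists l; split => //=; rewrite in_itv /= lexx lal.
- split=> [w []//|h]; have [_ /=] := h r Kr; rewrite in_itv /= => /andP[_]; lra.
have rl : 0 < r - l by rewrite subr_gt0.
apply: (lt_le_trans rl); apply: set_dist_ge.
- by exists l; split => //=; rewrite in_itv /= lexx lal.
- by exists r; split => // -[_ /=]; rewrite in_itv /= => /andP[_]; lra.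
move=> u v [Ku /=]; rewrite in_itv /= => /andP[_ ul] [Kv nv].
have vr : r <= v.
  rewrite leNgt; apply/negP => vr.
  have [vl|lv] := leP v l; last exact: free lv vr Kv.
  by apply: nv; split => //=; rewrite in_itv /= vl lal.
rewrite ler0_norm; lra.
Qed.
End window.

(** * Choice of a window for two interleaved sets *)

Section intersection.
Context {R : realType} {t : R} {tau : bool -> R}.
Hypothesis t0 : 0 < t.
Hypothesis kap0 : forall c, 0 < kap (t:=t) (tau:=tau) c.
Hypothesis disc0 : forall c, 0 < disc (t:=t) (tau:=tau) c.
Hypothesis psi0 : 0 < psi t (tau true) (tau false).
Hypothesis phi0 : 0 < phi t (tau true) (tau false).
Notation phi0' := (phi t (tau true) (tau false)).
Context {C : bool -> set R}.
Hypotheses (cC : forall i, compact (C i)) (thC : forall i, ((tau i)%:E <= thickness (C i))%E).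

Definition thick_core := exists K : set R,
  [/\ compact K, forall i, K `<=` C i & (phi0'%:E <= thickness K)%E].

Let tau_pos i : 0 < tau i.
Proof. exact: lt_trans t0 (tau_gt kap0 i). Qed.

Let bridge i l r l' r' : is_gap (C i) l r -> is_gap (C i) l' r' -> r <= l' ->
  r + tau i * Num.min (r - l) (r' - l') <= l'.
Proof. exact: gap_bridge. Qed.

Lemma window_thick_core c a b : a < b -> C c a -> C (~~ c) b ->
  (exists2 y, C c y & b <= y) -> (exists2 y, C (~~ c) y & y <= a) ->
  (forall l r, is_gap (C c) l r -> l < b -> a < r -> a + tau c * (r - l) <= l) ->
  (forall l r, is_gap (C (~~ c)) l r -> l < b -> a < r -> r + tau (~~ c) * (r - l) <= b) ->
  thick_core.
Proof.
move=> ab Ca Cb yb ya bl br; exists (window_core (t:=t) (tau:=tau) (C:=C) (c:=c) (a:=a) (b:=b)).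
split.
- exact: window_core_compact.
- by move=> i; apply: window_core_sub.
- exact: (core_thickness t0 kap0 disc0 psi0 phi0 ab bl br bridge).
Qed.

(** The outer gaps are the unbounded complementary intervals, which bound a chunk however long the
    neighbouring gap is. *)
Lemma overlapping_thick_core c a b : C c a -> C (~~ c) b -> a < b ->
  (forall y, C c y -> a <= y) -> (forall y, C (~~ c) y -> y <= b) ->
  (exists2 y, C c y & b <= y) -> (exists2 y, C (~~ c) y & y <= a) -> thick_core.
Proof.
move=> Ca Cb ab mina maxb yb ya; apply: (@window_thick_core c a b) => // l r g lb ar.
  apply: (gap_bridge_left _ _ _ _ _ (tau_pos c) (thC c)) => //.
    by move=> y /mina; lra.
  by case: g => Cl _ _ _; exact: mina.
apply: (gap_bridge_right _ _ _ _ _ (tau_pos (~~ c)) (thC (~~ c))) => //.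
  by move=> y /maxb; lra.
by case: g => _ Cr _ _; exact: maxb.
Qed.

(* When the hull of [C (~~ i)] lies inside the hull of [C i], the largest gap
   of [C i] that meets it plays the part of an outer gap of [C i]. *)
Lemma nested_thick_core i u v x : C (~~ i) u -> C (~~ i) v ->
  (forall y, C (~~ i) y -> u <= y <= v) ->
  (exists2 y, C i y & y <= u) -> (exists2 y, C i y & v <= y) ->
  C i x -> u < x -> x < v -> phi0' <= tau (~~ i) -> thick_core.
Proof.
move=> Cu Cv huv [y1 Cy1 y1u] [y2 Cy2 vy2] Cx ux xv phile.
(* If no gap of [C i] meets the inner hull, [C (~~ i)] is contained in [C i] and is itself the core;
   this is where [phile] enters. *)
have [nogap|gap] := pselect (forall l r, is_gap (C i) l r -> l <= v -> u <= r -> False).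
  exists (C (~~ i)); split => //; last by apply: le_trans (thC _); rewrite lee_fin.
  move=> j; have [->//|ji] := eqVneq j (~~ i).
  have -> : j = i by case: (j) ji; case: (i).
  move=> y /huv /andP[uy yv]; have [//|nC] := pselect (C i y); exfalso.
  have [l [r [g ly yr]]] := gap_around _ _ _ _ (cC i) Cy1 Cy2 (le_trans y1u uy)
    (le_trans yv vy2) nC.
  by apply: (nogap l r g); apply: ltW; [exact: lt_le_trans yv|exact: le_lt_trans yr].
have [l [r [g lv ur gmax]]] : exists l r, [/\ is_gap (C i) l r, l <= v, u <= r &
    forall l' r', is_gap (C i) l' r' -> l' <= v -> u <= r' -> r' - l' <= r - l].
  apply: (largest_gap (C i) u v x) => //; [exact: ltW|exact: ltW|].
  apply: contrapT => ng; apply: gap => l r g lv ur; apply: ng.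
  by exists l, r.
have [Cl Cr lr free] := g.
have inner_left l' r' b : is_gap (C (~~ i)) l' r' -> l' < b -> u < r' -> u + tau (~~ i)
  * (r' - l') <= l'.
  move=> g' _ _; apply: (gap_bridge_left _ _ _ _ _ (tau_pos (~~ i)) (thC (~~ i))) => //.
    by move=> y /huv; lra.
  by case: g' => /huv /andP[].
have inner_right l' r' a : is_gap (C (~~ i)) l' r' -> l' < v -> a < r' -> r' + tau (~~
  i) * (r' - l') <= v.
  move=> g' _ _; apply: (gap_bridge_right _ _ _ _ _ (tau_pos (~~ i)) (thC (~~ i))) => //.
    by move=> y /huv; lra.
  by case: g' => _ /huv /andP[].
(* The point [x], strictly inside the inner hull, shows on which side of the largest gap a window of
   positive length remains. *)
have [xl|lx] := leP x l.
  have ul : u < l by exact: lt_le_trans xl.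
  apply: (@window_thick_core (~~ i) u l) => //; rewrite ?negbK //.
  - by exists v.
  - by exists y1.
  - by move=> l' r' g' l'b ur'; apply: (inner_left _ _ l).
  move=> l' r' g' l'l ur'.
  have [Cl' Cr' lr' free'] := g'.
  apply: (gap_bridge_right _ _ _ _ _ (tau_pos i) (thC i)) => //.
    move=> y Cy ly; have := gmax _ _ g' (le_trans (ltW l'l) lv) (ltW ur').
    have [|yr] := leP r y; first by lra.
    by case: (free y ly yr).
  by rewrite leNgt; apply/negP => lr''; exact: (free' l).
have rx : r <= x by rewrite leNgt; apply/negP => xr; exact: (free x).
have rv : r < v by exact: le_lt_trans xv.
apply: (@window_thick_core i r v) => //.
- by exists y2.
- by exists u.
- move=> l' r' g' l'v rr'.
  have [Cl' Cr' lr' free'] := g'.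
  apply: (gap_bridge_left _ _ _ _ _ (tau_pos i) (thC i)) => //.
    move=> y Cy yr; have := gmax _ _ g' (ltW l'v) (le_trans ur (ltW rr')).
    have [|ly] := leP y l; first by lra.
    by case: (free y ly yr).
  by rewrite leNgt; apply/negP => lr''; exact: (free' r).
by move=> l' r' g' l'v rr'; apply: (inner_right _ _ r).
Qed.

Lemma interleaved_thick_core : interleaved (C true) (C false) ->
  (forall i, phi0' <= tau i) -> thick_core.
Proof.
move=> [[x1 [Cx1 ix1]] [x2 [Cx2 ix2]]] phile.
have [a1 Ca1 ha1] := compact_has_min _ (cC true) (ex_intro _ x1 Cx1).
have [b1 Cb1 hb1] := compact_has_max _ (cC true) (ex_intro _ x1 Cx1).
have [a2 Ca2 ha2] := compact_has_min _ (cC false) (ex_intro _ x2 Cx2).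
have [b2 Cb2 hb2] := compact_has_max _ (cC false) (ex_intro _ x2 Cx2).
have hull1 y : C true y -> a1 <= y <= b1 by move=> Cy; rewrite ha1 // hb1.
have hull2 y : C false y -> a2 <= y <= b2 by move=> Cy; rewrite ha2 // hb2.
have [a2x x1b] := interior_convex_hull _ _ _ _ hull2 ix1.
have [a1x x2b] := interior_convex_hull _ _ _ _ hull1 ix2.
have := hb1 _ Cx1 => x1b1; have := ha1 _ Cx1 => a1x1.
have := hb2 _ Cx2 => x2b2; have := ha2 _ Cx2 => a2x2.
have [a12|a21] := leP a1 a2.
  have [b12|b21] := leP b1 b2.
    apply: (@overlapping_thick_core false a2 b1) => //; [lra|by exists b2|by exists a1].
  apply: (@nested_thick_core true a2 b2 x1) => //; [by exists a1|by exists b1; rewrite ?ltW].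
have [b21|b12] := leP b2 b1.
  apply: (@overlapping_thick_core true a1 b2) => //; [lra|by exists b1|by exists a2; rewrite ?ltW].
by apply: (@nested_thick_core false a1 b1 x2) => //; [exists a2; rewrite ?ltW|exists b2;
  rewrite ?ltW].
Qed.
End intersection.

(** * Admissible values of the parameter [t] *)

Section values.
Context {R : realType}.
Implicit Types (t x y : R).

(** The quadratic terms in [t] cancel in [disc], which leaves [x * y - 1 - t * (x + y + 2)]; this is
    the origin of the upper bound on [t]. *)
Lemma disc_pos t x y : 0 < x -> 0 < y -> 0 < t < (x * y - 1) / (x + y + 2) ->
  [/\ 0 < x - t, 0 < y - t & 0 < (x - t) * (y - t) - (1 + t) ^+ 2].
Proof.
move=> x0 y0 /andP[t0]; have s0 : 0 < x + y + 2 by lra.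
rewrite ltr_pdivlMr // => h.
have lt z w : 0 < z -> 0 < w -> t * (z + w + 2) < z * w - 1 -> 0 < z - t.
  move=> z0 w0 h2; rewrite subr_gt0 ltNge; apply/negP => zt.
  have : z * (z + w + 2) <= t * (z + w + 2) by rewrite ler_pM2r //; lra.
  have := mulr_gt0 z0 z0; lra.
split; [exact: (lt x y)|apply: (lt y x) => //; lra|].
have -> : (x - t) * (y - t) - (1 + t) ^+ 2 = x * y - 1 - t * (x + y + 2) by ring.
by rewrite subr_gt0.
Qed.

(** The upper bound gives [phi <= t], hence [phi] below both thicknesses, as the case of a set
    contained in the other one demands. *)
Lemma phi_coef_bounds t x y : 0 < x -> 0 < t ->
  0 < (x - t) * (y - t) - (1 + t) ^+ 2 ->
  0 < (t * ((x - t) * (y - t) - (1 + t) ^+ 2)) /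
    ((x - t) * (y - t) + (1 + t) ^+ 2 * (2 * Num.max x y + 1)) <= t.
Proof.
move=> x0 t0 d0; set D := _ - _; set N := _ + _ * _.
have m0 : 0 < Num.max x y by rewrite lt_max x0.
have q0 : 0 < (1 + t) ^+ 2 by rewrite exprn_gt0 // addr_gt0.
have qm : 0 < (1 + t) ^+ 2 * (2 * Num.max x y + 1) by rewrite mulr_gt0 //; lra.
have DN : D <= N by rewrite /D /N; lra.
have N0 : 0 < N by exact: lt_le_trans DN.
by rewrite divr_gt0 ?mulr_gt0 //= ler_pdivrMr // ler_pM2l.
Qed.

(** The constant term in [t] is the polynomial that defines region $IV$, so [psi] is positive for
    small [t]. *)
Lemma psi_numerator t x y : 0 < x -> 0 < y -> 0 < t ->
  0 < (x - t) * (y - t) - (1 + t) ^+ 2 ->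
  psi t x y * (((x - t) * (y - t) - (1 + t) ^+ 2) * (x + 1 + t) * (y + 1 + t)) =
  x ^+ 2 * y ^+ 2 - 4 * x * y - 2 * x - 2 * y - 1
  - t * (2 + 4 * x + 4 * y + 8 * x * y + x ^+ 2 * y + x * y ^+ 2)
  - t ^+ 2 * (1 + 2 * x + 2 * y + 3 * x * y).
Proof.
move=> x0 y0 t0 d0; rewrite /psi /sigma /lambda.
have -> : (y - t) * (x - t) - (1 + t) ^+ 2 = (x - t) * (y - t) - (1 + t) ^+ 2 by ring.
have d1 : (x - t) * (y - t) - (1 + t) ^+ 2 != 0 by rewrite gt_eqF.
have x1 : x + 1 + t != 0 by rewrite gt_eqF //; lra.
have y1 : y + 1 + t != 0 by rewrite gt_eqF //; lra.
by field; rewrite x1 y1 d1.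
Qed.

Lemma region_IV_gt1 x y : region_IV x y -> 1 < x * y.
Proof.
move=> [x0 y0]; rewrite -exprMn_comm; last exact: mulrC.
have p0 := mulr_gt0 x0 y0; set p := x * y in p0 *.
have -> : 4 * x * y = 4 * p by rewrite /p mulrA.
move=> h; rewrite ltNge; apply/negP => p1.
have : p ^+ 2 <= p by rewrite expr2 -[leRHS]mulr1 ler_pM2l.
lra.
Qed.

Lemma phi_gt0_near0 x y : region_IV x y ->
  exists2 e, 0 < e & forall t, 0 < t < e ->
    0 < t < (x * y - 1) / (x + y + 2) /\ 0 < phi t x y.
Proof.
move=> xy; have p1 := region_IV_gt1 _ _ xy; case: xy => x0 y0 Q0.
set Q := (X in 0 < X) in Q0.
(* For [t < 1] one has [t ^+ 2 <= t], so [t * M] bounds the two subtracted terms of the numerator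
   together. *)
pose M := 2 + 4 * x + 4 * y + 8 * x * y + x ^+ 2 * y + x * y ^+ 2 +
  (1 + 2 * x + 2 * y + 3 * x * y).
have A0 : 0 < x ^+ 2 * y by rewrite mulr_gt0 // exprn_gt0.
have B0 : 0 < x * y ^+ 2 by rewrite mulr_gt0 // exprn_gt0.
have M0 : 0 < M by rewrite /M; lra.
have T0 : 0 < (x * y - 1) / (x + y + 2) by rewrite divr_gt0 //; lra.
exists (Num.min 1 (Num.min (Q / M) ((x * y - 1) / (x + y + 2)))).
  by rewrite !lt_min ltr01 T0 divr_gt0.
move=> t /andP[t0]; rewrite !lt_min => /and3P[t1 tQ tT].
have ht : 0 < t < (x * y - 1) / (x + y + 2) by rewrite t0.
split => //.
have [kx ky d0] := disc_pos _ _ _ x0 y0 ht.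
have /andP[c0 _] := phi_coef_bounds _ _ _ x0 t0 d0.
rewrite /phi pmulr_rgt0 //.
have e0 : 0 < ((x - t) * (y - t) - (1 + t) ^+ 2) * (x + 1 + t) * (y + 1 + t).
  by rewrite !mulr_gt0 //; lra.
rewrite -(pmulr_lgt0 _ e0) psi_numerator // -/Q.
have tM : t * M < Q by rewrite -ltr_pdivlMr.
have t2 : t ^+ 2 * (1 + 2 * x + 2 * y + 3 * x * y) <= t * (1 + 2 * x + 2 * y + 3 * x * y).
  rewrite ler_pM2r; last by lra.
  by rewrite expr2 -[leRHS]mulr1 ler_pM2l // ltW.
rewrite /M in tM; lra.
Qed.

Lemma infinite_of_interval (A : set R) (e : R) : 0 < e -> (forall t, 0 < t < e -> A t) ->
  infinite_set A.
Proof.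
(* [n.+2] keeps the value at [n = 0] strictly below [e]. *)
move=> e0 sub; apply/infiniteP; pose f (n : nat) : R := e / n.+2%:R.
have <- : f @^-1` A = [set: nat].
  apply/seteqP; split => // n _; apply: sub; rewrite /f divr_gt0 //=.
  by rewrite ltr_pdivrMr // ltr_pMr // ltr1n.
apply: card_ge_preimage => m n _ _ /mulfI; rewrite gt_eqF // => /(_ isT) /invr_inj /eqP.
by rewrite eqr_nat => /eqP [].
Qed.
End values.

Theorem proposition4p5 (R : realType) (tau1 tau2 : R)
    (htau : region_IV tau1 tau2) :
  infinite_set [set t : R | 0 < t < (tau1 * tau2 - 1) / (tau1 + tau2 + 2)
                            /\ 0 < phi t tau1 tau2] /\
  forall t : R, 0 < t < (tau1 * tau2 - 1) / (tau1 + tau2 + 2) ->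
    0 < phi t tau1 tau2 ->
    forall C1 C2 : set R, compact C1 -> compact C2 -> interleaved C1 C2 ->
      (tau1%:E <= thickness C1)%E -> (tau2%:E <= thickness C2)%E ->
      exists K : set R, [/\ compact K, K `<=` C1 `&` C2 &
        ((phi t tau1 tau2)%:E <= thickness K)%E].
Proof.
split.
  have [e e0 he] := phi_gt0_near0 _ _ htau.
  exact: infinite_of_interval e0 he.
move=> t ht phi0 C1 C2 cC1 cC2 inter th1 th2.
have [x0 y0 _] := htau.
have [kx ky d0] := disc_pos _ _ _ x0 y0 ht.
have t0 : 0 < t by case/andP: ht.
have /andP[c0 ct] := phi_coef_bounds _ _ _ x0 t0 d0.
have psi0 : 0 < psi t tau1 tau2 by move: phi0; rewrite /phi pmulr_rgt0.
pose tau i := if i then tau1 else tau2.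
pose C i := if i then C1 else C2.
have kap0 i : 0 < kap (t:=t) (tau:=tau) i by case: i.
have disc0 i : 0 < disc (t:=t) (tau:=tau) i.
  by case: i; rewrite -?(discC true) /disc /kap //= mulrC.
have cC i : compact (C i) by case: i.
have thC i : ((tau i)%:E <= thickness (C i))%E by case: i.
have phit : phi t tau1 tau2 <= t.
  apply: le_trans ct; rewrite /phi -[leRHS]mulr1 ler_pM2l //.
  have := psiE (tau := tau) true => /= ->.
  have := slam_ge0 t0 kap0 disc0 true; have := slam_ge0 t0 kap0 disc0 false; lra.
have phile i : phi t tau1 tau2 <= tau i.
  by apply: (le_trans phit); apply: ltW; rewrite -subr_gt0; exact: kap0.
have [K [cK KC thK]] :=
  interleaved_thick_core (tau := tau) t0 kap0 disc0 psi0 phi0 cC thC inter phile.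
by exists K; split => // x Kx; split; [exact: (KC true)|exact: (KC false)].
Qed.
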